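(* Let $n,k\ge1$, let $\sigma_0\in\Omega^0_{n,k}$ be of type $(t,d)$ and let $\mu=(\mu_1,\dots,\mu_t)$ be a partition. Put $\sigma=\sigma_0+\mu$. Then $\sigma\in\Sigma^0_{n,k}$ and $$\big(\det M^{(n,k)}_{d-n+k,\,t-n+k}\big)\,\delta_\mu,$$ viewed as an element of $\mathcal{I}\otimes\mathcal{H}$, is a highest weight vector in $\operatorname{Ker}\phi_\sigma^{(n,k)}$ of weight $\lambda'_{(k)}(\sigma)$.
   Context: $M_{k\times n}$ is the space of complex $k\times n$ matrices with coordinates $x_{ij}$, $\mathcal{P}=\mathbb{C}[x_{11},\dots,x_{kn}]$. $O(n)=O(n,\mathbb{C})$ preserves the form $(u,v)=\sum_{l=1}^n u_lv_{n+1-l}$ and acts on $\mathcal{P}$ by $(g\cdot P)(x)=P(xg)$. $\mathcal{I}$ is the ring of $O(n)$-invariants in $\mathcal{P}$, generated by $r_{ij}=r_{ji}=\sum_l x_{il}x_{j,n+1-l}$; $\mathcal{H}$ is the common kernel in $\mathcal{P}$ of all $\Delta_{ij}=\sum_l\partial_{x_{il}}\partial_{x_{j,n+1-l}}$. Let $\mathfrak{k}=\operatorname{span}\{h_{ij}:1\le i,j\le k\}\cong\mathfrak{gl}(k)$, $h_{ij}=\sum_l x_{il}\partial_{x_{jl}}+\frac n2\delta_{ij}$, and let $\varepsilon_1,\dots,\varepsilon_k$ be the basis of $\mathfrak{h}^*$, $\mathfrak{h}=\operatorname{span}\{h_{11},\dots,h_{kk}\}$, dual to $-h_{11},\dots,-h_{kk}$.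 Weights are identified with their coordinates $(\lambda_1,\dots,\lambda_k)$. The Lie algebra $\mathfrak{g}$ spanned by all $r_{ij},h_{ij},\Delta_{ij}$ is isomorphic to $\mathfrak{sp}(2k,\mathbb{C})$, with roots $\Delta=\{\pm\varepsilon_i\pm\varepsilon_j\ (i<j),\ \pm2\varepsilon_i\}$, simple roots $\varepsilon_i-\varepsilon_{i+1}$ ($i<k$) and $2\varepsilon_k$, positive roots $\Delta^+$, non-compact positive roots $\Delta_n^+=\{\varepsilon_i+\varepsilon_j:1\le i\le j\le k\}$, and half-sum of positive roots $\rho=(k,k-1,\dots,1)$. The vector $h_{ji}$ is a root vector for $\varepsilon_i-\varepsilon_j$, $i\ne j$. Labels. $\Sigma_{n,k}$ is the set of Young diagrams with at most $n$ boxes in the first two columns together and depth (number of nonzero rows) at most $k$. $\Omega_{n,k}\subset\Sigma_{n,k}$ consists of the diagrams with at most two columns; such $\sigma=(2,\dots,2,1,\dots,1)$ is of type $(t,d)$ if it has $t$ entries equal to $2$ and depth $d$ (so $t\le d\le k$, $t+d\le n$). For $\sigma\in\Sigma_{n,k}$, $\sigma^\sharp=(-\sigma_k-\frac n2,\dots,-\sigma_1-\frac n2)$. A partition is a finite weakly decreasing sequence of non-negative integers; sums of partitions are entrywise, padding by zeros. For $\lambda=\sigma^\sharp$ let $\Psi_\lambda=\{\alpha\in\Delta:(\alpha,\lambda+\rho)=0\}$ and let $\Gamma^k_\lambda$ be the set of $\alpha\in\Delta_n^+$ such that (i) $(\lambda+\rho,\alpha^\vee)\in\{1,2,3,\dots\}$,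 where $\alpha^\vee$ is the coroot; (ii) $\alpha$ is orthogonal to $\Psi_\lambda$; (iii) if $\Psi_\lambda$ contains a long root, then $\alpha$ is short (long roots are $\pm2\varepsilon_i$). Let $\Sigma^0_{n,k}=\{\sigma\in\Sigma_{n,k}:\Gamma^k_{\sigma^\sharp}\neq\emptyset\}$ and $\Omega^0_{n,k}=\Omega_{n,k}\cap\Sigma^0_{n,k}$. For $\sigma\in\Sigma^0_{n,k}$, the set $\Gamma^k_{\sigma^\sharp}$ has a unique minimum $\gamma$ in the usual partial order on roots ($\alpha\le\beta$ iff $\beta-\alpha$ is a (possibly empty) sum of positive roots), and $\lambda'_{(k)}(\sigma)=(s_\gamma(\sigma^\sharp+\rho))^+-\rho$, where $s_\gamma$ is the root reflection and $\mu^+$ denotes the weakly decreasing rearrangement of the coordinates of a weight $\mu$. Kernel. For $1\le j\le m=\min(n,k)$, $\delta_j$ is the determinant of the bottom right $j\times j$ submatrix of $x=(x_{il})_{k\times n}$, and for a partition $\nu$ of depth at most $m$, $\delta_\nu=\prod_{j=1}^m\delta_j^{\nu_j-\nu_{j+1}}$ ($\nu_{m+1}:=0$). $F_{\sigma^\sharp}\subset\mathcal{H}$ is the irreducible $\mathfrak{k}$-module generated by $\delta_\sigma$; it has highest weight $\sigma^\sharp$. $\phi_\sigma^{(n,k)}:\mathcal{I}\otimes F_{\sigma^\sharp}\to\mathcal{P}$ is $I\otimes H\mapsto IH$. $\mathfrak{k}$ acts on $\mathcal{I}\otimes F_{\sigma^\sharp}$ by $h_{ij}\cdot(I\otimes H)=\big(\sum_l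 x_{il}\partial_{x_{jl}}I\big)\otimes H+I\otimes h_{ij}H$. A highest weight vector of weight $\mu$ is a nonzero $v$ with $h_{ii}v=-\mu_iv$ for all $i$ and $h_{ji}v=0$ for all $i<j$. Matrices. $J_n$ is the $n\times n$ matrix with ones on the antidiagonal and zeros elsewhere, and $M^{(n,k)}=\begin{pmatrix}x\\ I_n\end{pmatrix}J_n\,(x^T,\,I_n)$ with $I_n$ the identity matrix, a symmetric $(n+k)\times(n+k)$ matrix whose upper left $k\times k$ block is $(r_{ij})$ and whose remaining entries are $x_{ij}$'s, $0$'s and $1$'s. $M^{(n,k)}_{a,b}$ ($a,b>0$) is the square submatrix of order $n+1$ whose $(i,j)$ entry is the $(a+i-1,b+j-1)$ entry of $M^{(n,k)}$. Its determinant is viewed as an element of $\mathcal{I}\otimes\mathcal{H}$ by formally expanding it and placing the sign $\otimes$ between the product of the $r_{ij}$ entries (in $\mathcal{I}$) and the product of the $x_{ij}$ entries; multiplying by $\delta_\mu$ means multiplying the right tensor factors by $\delta_\mu$.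
   Formalization: The vector is claimed to be a (nonzero) highest weight vector only when σ₀ is nonempty (d>0); for σ₀ empty it is an (n+1)-minor of (r_ij), which is 0 in P (e.g. n=1, k=2: r₁₁r₂₂−r₁₂²=0), and only the other conclusions are asserted. *)

(* Defs.v *)
From HB Require Import structures.
From mathcomp Require Import all_boot all_order all_algebra.
From mathcomp Require Import boolp classical_sets reals.
From mathcomp Require Import complex.
From mathcomp Require Import mpoly.
From mathcomp Require Import zify.

Set Implicit Arguments.
Unset Strict Implicit.
Unset Printing Implicit Defensive.

Import Order.TTheory GRing.Theory Num.Theory.
Local Open Scope classical_set_scope.
Local Open Scope ring_scope.

(* -------------------------------------------------------------------- *)
(* Partitions are weakly decreasing sequences of naturals, trailing      *)
(* zeros being allowed; the i-th part (i >= 1) is [nth 0 s i.-1].        *)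

Definition is_partition (s : seq nat) : bool := sorted geq s.

Definition depth (s : seq nat) : nat := count (fun r => 0 < r)%N s.

Definition boxes2 (s : seq nat) : nat := (\sum_(r <- s) minn r 2)%N.

Definition part_add (s u : seq nat) : seq nat :=
  mkseq (fun i => nth 0%N s i + nth 0%N u i)%N (maxn (size s) (size u)).

Definition in_Sigma (n k : nat) (s : seq nat) : bool :=
  [&& is_partition s, boxes2 s <= n & depth s <= k]%N.

Definition in_Omega (n k : nat) (s : seq nat) : bool :=
  in_Sigma n k s && all (fun r => r <= 2)%N s.

Definition has_type (s : seq nat) (t d : nat) : Prop :=
  count_mem 2%N s = t /\ depth s = d.

(* -------------------------------------------------------------------- *)
(* Coordinates on the basis eps_1, ..., eps_k of h^*. All the weights    *)
(* considered here are half-integral, whence the rational coordinates.   *)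

Definition eps (k : nat) (i : 'I_k) : 'rV[rat]_k := delta_mx 0 i.

Definition wdot (k : nat) (u v : 'rV[rat]_k) : rat := \sum_i u 0 i * v 0 i.

Definition coroot (k : nat) (a : 'rV[rat]_k) : 'rV[rat]_k :=
  (2 / wdot a a) *: a.

Definition reflection (k : nat) (a v : 'rV[rat]_k) : 'rV[rat]_k :=
  v - wdot v (coroot a) *: a.

Definition short_roots (k : nat) : set 'rV[rat]_k :=
  [set a | exists (i j : 'I_k) (b c : bool),
     (i < j)%N /\ a = (-1) ^+ b *: eps i + (-1) ^+ c *: eps j].
Arguments short_roots k _ : clear implicits.

Definition long_roots (k : nat) : set 'rV[rat]_k :=
  [set a | exists (i : 'I_k) (b : bool), a = (-1) ^+ b *: (2 *: eps i)].
Arguments long_roots k _ : clear implicits.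

Definition roots (k : nat) : set 'rV[rat]_k := short_roots k `|` long_roots k.
Arguments roots k _ : clear implicits.

Definition positive_roots (k : nat) : set 'rV[rat]_k :=
  [set a | (exists i j : 'I_k,
              (i < j)%N /\ (a = eps i - eps j \/ a = eps i + eps j))
           \/ exists i : 'I_k, a = 2 *: eps i].
Arguments positive_roots k _ : clear implicits.

Definition noncompact_positive_roots (k : nat) : set 'rV[rat]_k :=
  [set a | exists i j : 'I_k, (i <= j)%N /\ a = eps i + eps j].
Arguments noncompact_positive_roots k _ : clear implicits.

Definition rho (k : nat) : 'rV[rat]_k := \row_(i < k) (k - i)%N%:R.

Definition root_le (k : nat) (a b : 'rV[rat]_k) : Prop :=
  exists s : seq 'rV[rat]_k,
    (forall c, c \in s -> positive_roots k c) /\ b - a = \sum_(c <- s) c.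

Definition Psi (k : nat) (lam : 'rV[rat]_k) : set 'rV[rat]_k :=
  [set a | roots k a /\ wdot a (lam + rho k) = 0].

Definition Gamma (k : nat) (lam : 'rV[rat]_k) : set 'rV[rat]_k :=
  [set a | [/\ noncompact_positive_roots k a,
               exists2 m : nat, (0 < m)%N & wdot (lam + rho k) (coroot a) = m%:R,
               forall b, Psi lam b -> wdot a b = 0
             & (exists2 b, Psi lam b & long_roots k b) -> short_roots k a]].

Definition is_least_Gamma (k : nat) (lam g : 'rV[rat]_k) : Prop :=
  Gamma lam g /\ forall b, Gamma lam b -> root_le g b.

(* [root_le] is antisymmetric, so there is at most one candidate; the    *)
(* value is 0 if there is none.                                          *)
Definition min_Gamma (k : nat) (lam : 'rV[rat]_k) : 'rV[rat]_k :=
  xget 0 [set g | is_least_Gamma lam g].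

Definition decreasing_rearrangement (k : nat) (v : 'rV[rat]_k) : 'rV[rat]_k :=
  \row_(i < k) nth 0 (sort (fun x y => y <= x) [seq v 0 j | j <- enum 'I_k]) i.

Definition sharp (n k : nat) (s : seq nat) : 'rV[rat]_k :=
  \row_(i < k) (- (nth 0%N s (rev_ord i))%:R - n%:R / 2).

Definition in_Sigma0 (n k : nat) (s : seq nat) : Prop :=
  in_Sigma n k s /\ Gamma (sharp n k s) !=set0.

Definition in_Omega0 (n k : nat) (s : seq nat) : Prop :=
  in_Omega n k s /\ in_Sigma0 n k s.

Definition lambda_prime (n k : nat) (s : seq nat) : 'rV[rat]_k :=
  let lam := sharp n k s in
  decreasing_rearrangement (reflection (min_Gamma lam) (lam + rho k)) - rho k.

(* -------------------------------------------------------------------- *)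

Definition antidiag (R : pzSemiRingType) (n : nat) : 'M[R]_n :=
  \matrix_(i, j) (j == rev_ord i)%:R.

Definition entry (R : nmodType) (m n : nat) (A : 'M[R]_(m, n)) (i j : nat) : R :=
  if insub i is Some i' then if insub j is Some j' then A i' j' else 0 else 0.

(* Square submatrix of order s of A whose upper left corner is the entry *)
(* in row a and column b of A, rows and columns being counted from 0.    *)
Definition submx_at (R : nmodType) (m n : nat) (A : 'M[R]_(m, n))
    (s a b : nat) : 'M[R]_s :=
  \matrix_(i < s, j < s) entry A (a + i) (b + j).

(* -------------------------------------------------------------------- *)
(* The polynomial ring P on k x n matrices; the coordinate x_ij is the   *)
(* variable of index [mxvec_index i j].                                  *)

Definition xmx (C : fieldType) (n k : nat) : 'M[{mpoly C[k * n]}]_(k, n) :=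
  \matrix_(i, j) 'X_(mxvec_index i j).

Definition dx (C : fieldType) (n k : nat) (i : 'I_k) (j : 'I_n)
    (p : {mpoly C[k * n]}) : {mpoly C[k * n]} := mderiv (mxvec_index i j) p.

Definition polarization (C : fieldType) (n k : nat) (i j : 'I_k)
    (p : {mpoly C[k * n]}) : {mpoly C[k * n]} :=
  \sum_(l < n) xmx C n k i l * dx j l p.

Definition hop (C : fieldType) (n k : nat) (i j : 'I_k)
    (p : {mpoly C[k * n]}) : {mpoly C[k * n]} :=
  polarization i j p + (n%:R / 2 * (i == j)%:R) *: p.

Definition Laplacian (C : fieldType) (n k : nat) (i j : 'I_k)
    (p : {mpoly C[k * n]}) : {mpoly C[k * n]} :=
  \sum_(l < n) dx i l (dx j (rev_ord l) p).

(* (u, v) = u J v^T on row vectors, and u is sent to u g *)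
Definition orthogonal (C : fieldType) (n : nat) (g : 'M[C]_n) : Prop :=
  g *m antidiag C n *m g^T = antidiag C n.

Definition translate (C : fieldType) (n k : nat) (g : 'M[C]_n)
    (p : {mpoly C[k * n]}) : {mpoly C[k * n]} :=
  p \mPo [tuple mxvec (xmx C n k *m map_mx (@mpolyC _ _) g) 0 u | u < k * n].

Definition invariants (C : fieldType) (n k : nat) : set {mpoly C[k * n]} :=
  [set p | forall g : 'M[C]_n, orthogonal g -> translate g p = p].
Arguments invariants C n k _ : clear implicits.

Definition harmonics (C : fieldType) (n k : nat) : set {mpoly C[k * n]} :=
  [set p | forall i j : 'I_k, Laplacian i j p = 0].
Arguments harmonics C n k _ : clear implicits.

Definition delta_minor (C : fieldType) (n k j : nat) : {mpoly C[k * n]} :=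
  \det (submx_at (xmx C n k) j (k - j) (n - j)).

(* The last exponent is nu_m, as nu has depth at most m. *)
Definition delta_part (C : fieldType) (n k : nat) (nu : seq nat) :
    {mpoly C[k * n]} :=
  \prod_(1 <= j < (minn n k).+1)
    delta_minor C n k j ^+ (nth 0%N nu j.-1 - nth 0%N nu j).

Inductive k_submodule_gen (C : fieldType) (n k : nat) (p0 : {mpoly C[k * n]}) :
    {mpoly C[k * n]} -> Prop :=
| kgen_base : k_submodule_gen p0 p0
| kgen_add p q of k_submodule_gen p0 p & k_submodule_gen p0 q :
    k_submodule_gen p0 (p + q)
| kgen_scale (c : C) p of k_submodule_gen p0 p : k_submodule_gen p0 (c *: p)
| kgen_act (i j : 'I_k) p of k_submodule_gen p0 p :
    k_submodule_gen p0 (hop i j p).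

Definition Fmod (C : fieldType) (n k : nat) (s : seq nat) :
    set {mpoly C[k * n]} :=
  [set p | k_submodule_gen (delta_part C n k s) p].
Arguments Fmod C n k s _ : clear implicits.

(* -------------------------------------------------------------------- *)
(* P (x) P is realized as the polynomial ring in two sets of variables,  *)
(* p (x) q being p(x) q(y); over a field, A (x) B embeds in P (x) P for  *)
(* all subspaces A and B of P, as the span of the p (x) q.               *)

Definition tens (C : fieldType) (N : nat) (p q : {mpoly C[N]}) :
    {mpoly C[N + N]} :=
  (p \mPo [tuple 'X_(lshift N u) | u < N])
  * (q \mPo [tuple 'X_(rshift N u) | u < N]).

Definition tens_span (C : fieldType) (N : nat) (A B : set {mpoly C[N]}) :
    set {mpoly C[N + N]} :=
  [set v | exists s : seq ({mpoly C[N]} * {mpoly C[N]}),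
     (forall pq, pq \in s -> A pq.1 /\ B pq.2)
     /\ v = \sum_(pq <- s) tens pq.1 pq.2].

(* p (x) q |-> p q *)
Definition tens_mul (C : fieldType) (N : nat) (v : {mpoly C[N + N]}) :
    {mpoly C[N]} :=
  v \mPo [tuple match split u with inl a => 'X_a | inr a => 'X_a end
         | u < N + N].

(* The action of h_ij; see [tens_hop_tens] for its value on p (x) q. *)
Definition tens_hop (C : fieldType) (n k : nat) (i j : 'I_k)
    (v : {mpoly C[k * n + k * n]}) : {mpoly C[k * n + k * n]} :=
  \sum_(l < n) 'X_(lshift (k * n) (mxvec_index i l))
               * mderiv (lshift (k * n) (mxvec_index j l)) v
  + \sum_(l < n) 'X_(rshift (k * n) (mxvec_index i l))
                 * mderiv (rshift (k * n) (mxvec_index j l)) v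
  + (n%:R / 2 * (i == j)%:R) *: v.

Definition ker_phi (C : fieldType) (n k : nat) (s : seq nat) :
    set {mpoly C[k * n + k * n]} :=
  [set v | tens_span (invariants C n k) (Fmod C n k s) v /\ tens_mul v = 0].
Arguments ker_phi C n k s _ : clear implicits.

Definition is_highest_weight_vector (C : fieldType) (n k : nat)
    (mu : 'rV[rat]_k) (v : {mpoly C[k * n + k * n]}) : Prop :=
  [/\ v != 0,
      forall i : 'I_k, tens_hop i i v = - ratr (mu 0 i) *: v
    & forall i j : 'I_k, (i < j)%N -> tens_hop j i v = 0].

Definition Mmx (C : fieldType) (n k : nat) : 'M[{mpoly C[k * n]}]_(k + n) :=
  col_mx (xmx C n k) 1%:M *m antidiag _ n *m row_mx (xmx C n k)^T 1%:M.

(* Entries in the upper left k x k block (the r_ij) go to the left       *)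
(* tensor factor, all the others to the right one; determinants are then *)
(* computed in the commutative algebra P (x) P.                          *)
Definition Mmx_tens (C : fieldType) (n k : nat) :
    'M[{mpoly C[k * n + k * n]}]_(k + n) :=
  \matrix_(i, j) if (i < k)%N && (j < k)%N then tens (Mmx C n k i j) 1
                 else tens 1 (Mmx C n k i j).

(* (det M_{a,b}) delta_mu, with a, b >= 1 *)
Definition det_vector (C : fieldType) (n k a b : nat) (mu : seq nat) :
    {mpoly C[k * n + k * n]} :=
  \det (submx_at (Mmx_tens C n k) n.+1 a.-1 b.-1)
  * tens 1 (delta_part C n k mu).

(* -------------------------------------------------------------------- *)

Lemma tens_mul_tens (C : fieldType) (N : nat) (p q : {mpoly C[N]}) :
  tens_mul (tens p q) = p * q.
Proof.
have comp lq r : tens_mul (r \mPo lq) = r \mPo [tuple tens_mul (tnth lq u) | u < N].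
  elim/mpolyind: r => [|c m r _ _ IH].
    by rewrite /tens_mul !comp_mpoly0.
  rewrite /tens_mul in IH *; rewrite !comp_mpolyD IH; congr (_ + _).
  rewrite !comp_mpolyZ; congr (_ *: _).
  rewrite !comp_mpolyX rmorph_prod; apply: eq_bigr => u _.
  by rewrite rmorphXn tnth_mktuple.
rewrite /tens /tens_mul rmorphM /= -!/(tens_mul _) !comp.
congr (_ * _); rewrite -[RHS]comp_mpoly_id; congr comp_mpoly;
  apply: eq_from_tnth => u; rewrite !tnth_mktuple /tens_mul comp_mpolyXU.
  by rewrite -tnth_nth tnth_mktuple -/(unsplit (inl u)) unsplitK.
by rewrite -tnth_nth tnth_mktuple -/(unsplit (inr u)) unsplitK.
Qed.

Lemma subUm0 N (u : 'I_N) : (U_(u) - U_(u) = 0 :> 'X_{1..N})%MM.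
Proof. by apply/mnmP => v; rewrite mnmBE subnn mnm0E. Qed.

Lemma mderiv_comp_mpoly (C : fieldType) (N M : nat) (lq : N.-tuple {mpoly C[M]})
    (w : 'I_M) (p : {mpoly C[N]}) :
  mderiv w (p \mPo lq)
  = \sum_(u < N) mderiv w (tnth lq u) * (mderiv u p \mPo lq).
Proof.
have mulD p1 p2 :
    mderiv w (p1 \mPo lq)
      = \sum_(u < N) mderiv w (tnth lq u) * (mderiv u p1 \mPo lq) ->
    mderiv w (p2 \mPo lq)
      = \sum_(u < N) mderiv w (tnth lq u) * (mderiv u p2 \mPo lq) ->
    mderiv w ((p1 * p2) \mPo lq)
      = \sum_(u < N) mderiv w (tnth lq u) * (mderiv u (p1 * p2) \mPo lq).
  move=> e1 e2; rewrite rmorphM /= mderivM e1 e2 mulr_suml mulr_sumr -big_split /=.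
  apply: eq_bigr => u _; rewrite mderivM rmorphD !rmorphM /= mulrDr.
  by congr (_ + _); [rewrite mulrA | rewrite mulrCA].
have one : mderiv w ((1 : {mpoly C[N]}) \mPo lq)
      = \sum_(u < N) mderiv w (tnth lq u) * (mderiv u 1 \mPo lq).
  rewrite comp_mpoly1 -mpolyC1 mderivC big1 // => u _.
  by rewrite mderivC comp_mpoly0 mulr0.
have var u0 : mderiv w ('X_u0 \mPo lq)
      = \sum_(u < N) mderiv w (tnth lq u) * (mderiv u 'X_u0 \mPo lq).
  rewrite comp_mpolyXU -tnth_nth (bigD1 u0) //= mderivX mnm1E eqxx subUm0.
  rewrite scale1r mpolyX0 comp_mpoly1 mulr1 big1 ?addr0 // => u neq_u.
  by rewrite mderivX mnm1E eq_sym (negPf neq_u) scale0r comp_mpoly0 mulr0.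
elim/mpolyind: p => [|c m r _ _ IH].
  rewrite comp_mpoly0 mderiv0 big1 // => u _.
  by rewrite mderiv0 comp_mpoly0 mulr0.
rewrite comp_mpolyD mderivD IH comp_mpolyZ mderivZ.
have -> : mderiv w ('X_[m] \mPo lq)
    = \sum_(u < N) mderiv w (tnth lq u) * (mderiv u 'X_[m] \mPo lq).
  rewrite mpolyXE_id.
  elim/big_rec: _ => // u0 y _; apply: (mulD).
  by elim: (m u0) => [|e IHe]; rewrite ?expr0 // exprS; apply: (mulD).
rewrite scaler_sumr -big_split; apply: eq_bigr => u _ /=.
by rewrite mderivD mderivZ comp_mpolyD comp_mpolyZ mulrDr scalerAr.
Qed.

Lemma tens_hop_tens (C : fieldType) (n k : nat) (i j : 'I_k)
    (p q : {mpoly C[k * n]}) :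
  tens_hop i j (tens p q) = tens (polarization i j p) q + tens p (hop i j q).
Proof.
have dl u v :
    mderiv (lshift (k * n) u) ('X_(lshift (k * n) v) : {mpoly C[_]}) = (u == v)%:R.
  rewrite mderivX mnm1E (inj_eq (@lshift_inj _ _)) eq_sym.
  by case: eqP => [->|]; rewrite ?scale0r // subUm0 mpolyX0 scale1r.
have dr u v :
    mderiv (rshift (k * n) u) ('X_(rshift (k * n) v) : {mpoly C[_]}) = (u == v)%:R.
  rewrite mderivX mnm1E (inj_eq (@rshift_inj _ _)) eq_sym.
  by case: eqP => [->|]; rewrite ?scale0r // subUm0 mpolyX0 scale1r.
have dlr u v :
    mderiv (lshift (k * n) u) ('X_(rshift (k * n) v) : {mpoly C[_]}) = 0.
  by rewrite mderivX mnm1E eq_rlshift scale0r.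
have drl u v :
    mderiv (rshift (k * n) u) ('X_(lshift (k * n) v) : {mpoly C[_]}) = 0.
  by rewrite mderivX mnm1E eq_lrshift scale0r.
pose L := [tuple ('X_(lshift (k * n) u) : {mpoly C[_]}) | u < k * n].
pose R := [tuple ('X_(rshift (k * n) u) : {mpoly C[_]}) | u < k * n].
have cl u r : mderiv (lshift (k * n) u) (r \mPo L) = mderiv u r \mPo L.
  rewrite mderiv_comp_mpoly (bigD1 u) //= tnth_mktuple dl eqxx mul1r big1 ?addr0 //.
  by move=> v neq_v; rewrite tnth_mktuple dl eq_sym (negPf neq_v) mul0r.
have cr u r : mderiv (rshift (k * n) u) (r \mPo R) = mderiv u r \mPo R.
  rewrite mderiv_comp_mpoly (bigD1 u) //= tnth_mktuple dr eqxx mul1r big1 ?addr0 //.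
  by move=> v neq_v; rewrite tnth_mktuple dr eq_sym (negPf neq_v) mul0r.
have clr u r : mderiv (lshift (k * n) u) (r \mPo R) = 0.
  by rewrite mderiv_comp_mpoly big1 // => v _; rewrite tnth_mktuple dlr mul0r.
have crl u r : mderiv (rshift (k * n) u) (r \mPo L) = 0.
  by rewrite mderiv_comp_mpoly big1 // => v _; rewrite tnth_mktuple drl mul0r.
rewrite /tens_hop /hop /polarization /tens -/L -/R -addrA; congr (_ + _).
  rewrite raddf_sum [RHS]mulr_suml; apply: eq_bigr => l _ /=.
  rewrite mderivM cl clr mulr0 addr0 mulrA rmorphM /= mxE.
  by rewrite comp_mpolyXU -tnth_nth tnth_mktuple.
rewrite comp_mpolyD comp_mpolyZ mulrDr -scalerAr; congr (_ + _).
rewrite raddf_sum [RHS]mulr_sumr; apply: eq_bigr => l _ /=.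
rewrite mderivM crl mul0r add0r cr rmorphM /= mxE mulrCA.
by rewrite comp_mpolyXU -tnth_nth tnth_mktuple.
Qed.

Lemma Mmx_ul (C : fieldType) (n k : nat) (i j : 'I_k) :
  Mmx C n k (lshift n i) (lshift n j)
  = \sum_(l < n) xmx C n k i l * xmx C n k j (rev_ord l).
Proof.
rewrite /Mmx mul_col_mx mul_col_row block_mxEul mxE.
rewrite (reindex_inj rev_ord_inj); apply: eq_bigr => l _ /=.
rewrite mxE (bigD1 l) //= big1 ?addr0 => [|l' neq_l'].
  by rewrite !mxE eqxx mulr1.
by rewrite [antidiag _ _ _ _]mxE (inj_eq rev_ord_inj) eq_sym (negPf neq_l') mulr0.
Qed.

(* Since the r_ij are polynomials in the x_il, the matrix (r_ij) has     *)
(* rank at most n: for the empty diagram (t = d = 0, so that k > n) the  *)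
(* determinant is a minor of order n + 1 of that matrix.                 *)
Lemma det_vector_empty (C : fieldType) (n k : nat) (mu : seq nat) :
  (n < k)%N -> det_vector C n k (k - n) (k - n) mu = 0.
Proof.
move=> lt_nk; rewrite /det_vector.
pose ri (i : 'I_n.+1) : nat := ((k - n).-1 + i)%N.
have lt_ri i : (ri i < k)%N by rewrite /ri; have := ltn_ord i; lia.
pose f i := Ordinal (lt_ri i).
pose A : 'M[{mpoly C[k * n + k * n]}]_(n.+1, n) :=
  \matrix_(i, l) tens (xmx C n k (f i) l) 1.
pose B : 'M[{mpoly C[k * n + k * n]}]_(n, n.+1) :=
  \matrix_(l, i) tens (xmx C n k (f i) (rev_ord l)) 1.
have -> : submx_at (Mmx_tens C n k) n.+1 (k - n).-1 (k - n).-1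
    = (row_mx (0 : 'M_(n.+1, 1)) A : 'M_n.+1) *m col_mx (0 : 'M_(1, n.+1)) B.
  rewrite (mul_row_col (0 : 'M_(n.+1, 1)) A) mul0mx add0r.
  apply/matrixP => i j; rewrite !mxE /entry.
  have lt_kn (l : 'I_n.+1) : (ri l < k + n)%N by rewrite ltn_addr.
  rewrite (insubT (fun m => m < k + n)%N (lt_kn i)).
  rewrite (insubT (fun m => m < k + n)%N (lt_kn j)) /=.
  have -> : Sub (ri i) (lt_kn i) = lshift n (f i) by apply: val_inj.
  have -> : Sub (ri j) (lt_kn j) = lshift n (f j) by apply: val_inj.
  rewrite mxE /= !lt_ri /= Mmx_ul /tens comp_mpoly1 mulr1 raddf_sum /=.
  apply: eq_bigr => l _.
  by rewrite rmorphM /= [A _ _]mxE [B _ _]mxE /tens comp_mpoly1 !mulr1.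
rewrite det_mulmx (expand_det_col _ (lshift n (ord0 : 'I_1))) big1 ?mul0r // => i _.
by rewrite row_mxEl mxE mul0r.
Qed.

(* Main.v *)
Require Import Defs.
From HB Require Import structures.
From mathcomp Require Import all_boot all_order all_algebra all_fingroup.
From mathcomp Require Import boolp classical_sets reals.
From mathcomp Require Import complex.
From mathcomp Require Import mpoly.
From mathcomp Require Import zify ring lra.

Set Implicit Arguments.
Unset Strict Implicit.
Unset Printing Implicit Defensive.

Import Order.TTheory GRing.Theory Num.Theory.
Local Open Scope ring_scope.

(** The vector is the determinant of a window [[r, Y], [Z, 0]] of the bordered
    matrix.  The block [r] is taken from the Gram matrix (r_ij), the blocks [Y]
    and [Z^T] from the last [t] and the last [d] columns of the second copy of
    the variables, and the last block vanishes because [t + d <= n].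

    Expanding along the rows of [Z] and the columns of [Y]
    ([det_submx_Mt_expansion]) writes the vector as a sum of tensors of an
    invariant with a product of a [d]-minor, a [t]-minor and [delta_part mu].
    Such a product is harmonic ([harmonic_rminor_mul]), the Laplacian being
    symmetric in pairs of complementary columns and minors antisymmetric.  It
    also lies in the module generated by [delta_part sigma]: all the products of
    row minors of given sizes do ([minor_products_generated]).  The reason is
    the Fischer form, for which h_ij and h_ji are adjoint.  By weights, pairing
    a product of minors with the bottom one amounts to evaluating it at one
    point, the matrix [bottom_id]; hence a combination orthogonal to the
    generated module vanishes at [bottom_id] together with all its
    polarizations, which forces it to be zero ([vanish_on_orbit]), and one
    concludes by dimension.

    The multiplication map turns the window into a window of order [n + 1] of
    a matrix that factors through a free module of rank [n], so it kills the
    vector.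

    The operator h_ij acts on the window by adding a row to a row and a column
    to a column, so the determinant is an eigenvector of the diagonal ones and is
    killed by the raising ones ([eigen_window]).  Its weight is that of the
    diagram obtained by adding [mu] to the two-column diagram with [n - d + 1]
    entries 2 and depth [n - t + 1].  It is nonzero as soon as [0 < d]
    ([det_vector_neq0]).

    There remains to see that this weight is the one prescribed by the minimal
    root.  Up to the shift by [n / 2], the coordinates of lambda + rho are
    integers [ucoord j], namely [t] integers at most [t - 2], and all the
    integers from [t] to [k] except [d].  Reflections in the roots considered
    replace two of them, [u] and [u'], by [n - u'] and [n - u].  Those whose
    opposite [n - u] is not attained and which belong to a pair of sum greater
    than [n] are [n - d] (if it differs from [d]) and some integers above
    [n - t], so the minimal root corresponds to [n - d] and [n - t + 1]
    ([nonsingular_pair_min]).  Replacing these by [t - 1] and [d] yields the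
    coordinates of the diagram above ([ucoord_refl_image]). *)

(** * Determinants and derivations *)

Lemma det_perm_mxsub (R : comNzRingType) (n : nat) (s : 'S_n) (A : 'M[R]_n) :
  \det (\matrix_(i, j) A (s i) (s j)) = \det A.
Proof.
have -> : \matrix_(i, j) A (s i) (s j) = row_perm s (col_perm s A).
  by apply/matrixP => i j; rewrite !mxE.
rewrite row_permE col_permE !det_mulmx !det_perm.
by rewrite odd_permV mulrC -mulrA -signr_addb addbb mulr1.
Qed.

Lemma det_castmx (R : comNzRingType) (n n' : nat) (e : n = n') (A : 'M[R]_n) :
  \det (castmx (e, e) A) = \det A.
Proof. by case: n' / e; rewrite castmx_id. Qed.

(** Padding [A] with a zero column and [B] with a zero row makes them square, and
    then the determinant is multiplicative. *)
Lemma det_low_rank (R : comNzRingType) (n : nat)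
    (A : 'M[R]_(n.+1, n)) (B : 'M[R]_(n, n.+1)) : \det (A *m B) = 0.
Proof.
have -> : A *m B = (row_mx (0 : 'M_(n.+1, 1)) A : 'M_n.+1)
                     *m col_mx (0 : 'M_(1, n.+1)) B.
  by rewrite (mul_row_col (0 : 'M_(n.+1, 1)) A) mul0mx add0r.
rewrite det_mulmx (expand_det_col _ (lshift n (ord0 : 'I_1))) big1 ?mul0r // => i _.
by rewrite row_mxEl mxE mul0r.
Qed.

Section BlockExpansion.
Variable R : comNzRingType.

Lemma det_col_mx_row_perm m d (U : 'M[R]_(m, m + d)) (p : 'S_d)
    (Z : 'M[R]_(d, m + d)) :
  \det (col_mx U (row_perm p Z)) = (-1) ^+ p * \det (col_mx U Z).
Proof.
have -> : col_mx U (row_perm p Z)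
          = block_mx 1%:M 0 0 (perm_mx p) *m col_mx U Z.
  by rewrite mul_block_col mul1mx !mul0mx addr0 add0r -row_permE.
by rewrite det_mulmx det_ublock det1 mul1r det_perm.
Qed.

Lemma det_col_mx_mul m d q (U : 'M[R]_(m, m + d)) (Z : 'M[R]_(d, q))
    (W : 'M[R]_(q, m + d)) :
  \det (col_mx U (Z *m W))
  = \sum_(f : {ffun 'I_d -> 'I_q})
      (\prod_l Z l (f l)) * \det (col_mx U (rowsub f W)).
Proof.
pose T (s : 'S_(m + d)) := (-1) ^+ s * \prod_i U i (s (lshift d i)).
transitivity (\sum_(s : 'S_(m + d)) \sum_(f : {ffun 'I_d -> 'I_q})
    T s * \prod_l (Z l (f l) * W (f l) (s (rshift m l)))).
  apply: eq_bigr => s _; rewrite big_split_ord /= mulrA -mulr_sumr; congr (_ * _).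
    by congr (_ * _); apply: eq_bigr => i _; rewrite col_mxEu.
  rewrite -(bigA_distr_bigA (fun l j => Z l j * W j (s (rshift m l)))) /=.
  by apply: eq_bigr => l _; rewrite col_mxEd mxE.
rewrite exchange_big /=; apply: eq_bigr => f _; rewrite mulr_sumr.
apply: eq_bigr => s _; rewrite big_split_ord /= big_split /= /T.
under [\prod_i col_mx _ _ (lshift _ _) _]eq_bigr do rewrite col_mxEu.
under [\prod_i col_mx _ _ (rshift _ _) _]eq_bigr do rewrite col_mxEd mxE.
by rewrite mulrCA !mulrA.
Qed.

(** Expanding [Z *m W] row by row makes the coefficient of a choice [f] of
    rows of [W] a plain product; averaging over the permutations of the last
    [d] rows turns that product into a minor of [Z], at the price of the
    factor [d`!]. *)
Lemma det_col_mx_mul_minors m d q (U : 'M[R]_(m, m + d)) (Z : 'M[R]_(d, q))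
    (W : 'M[R]_(q, m + d)) :
  \det (col_mx U (Z *m W)) *+ d`!
  = \sum_(f : {ffun 'I_d -> 'I_q})
      \det (colsub f Z) * \det (col_mx U (rowsub f W)).
Proof.
have step (p : 'S_d) : \det (col_mx U (Z *m W))
    = \sum_(f : {ffun 'I_d -> 'I_q})
      ((-1) ^+ p * \prod_l Z l (f (p l))) * \det (col_mx U (rowsub f W)).
  rewrite det_col_mx_mul.
  rewrite (reindex_inj (h := fun f : {ffun 'I_d -> 'I_q} => [ffun l => f (p l)])).
    apply: eq_bigr => f _.
    have -> : rowsub [ffun l => f (p l)] W = row_perm p (rowsub f W).
      by apply/matrixP => i j; rewrite !mxE ffunE.
    rewrite det_col_mx_row_perm mulrA; congr (_ * _); rewrite mulrC; congr (_ * _).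
    by apply: eq_bigr => l _; rewrite ffunE.
  move=> f g /ffunP efg; apply/ffunP => l.
  by have := efg (p^-1%g l); rewrite !ffunE permKV.
rewrite -[d`!]card_Sn -sumr_const (eq_bigr _ (fun p _ => step p)).
rewrite exchange_big /=; apply: eq_bigr => f _.
rewrite -mulr_suml; congr (_ * _); apply: eq_bigr => p _; congr (_ * _).
by apply: eq_bigr => l _; rewrite mxE.
Qed.

End BlockExpansion.

Definition derivation (R : comNzRingType) (D : R -> R) : Prop :=
  (forall p q, D (p + q) = D p + D q) /\ (forall p q, D (p * q) = D p * q + p * D q).

Section Derivations.
Variables (R : comNzRingType) (D : R -> R).
Hypothesis derD : derivation D.
Let DD := derD.1.
Let DM := derD.2.

Lemma derivation0 : D 0 = 0.
Proof. by apply: (addrI (D 0)); rewrite -DD !addr0. Qed.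

Lemma derivation1 : D 1 = 0.
Proof. by apply: (addrI (D 1)); have := DM 1 1; rewrite !mulr1 mul1r addr0 => <-. Qed.

Lemma derivationN p : D (- p) = - D p.
Proof. by apply/eqP; rewrite -subr_eq0 opprK -DD addNr derivation0. Qed.

Lemma derivation_sum I (r : seq I) (P : pred I) F :
  D (\sum_(i <- r | P i) F i) = \sum_(i <- r | P i) D (F i).
Proof. exact: (big_morph D DD derivation0). Qed.

Lemma derivation_signr (b : bool) p : D ((-1) ^+ b * p) = (-1) ^+ b * D p.
Proof. by case: b; rewrite ?expr0 ?mul1r // expr1 !mulN1r derivationN. Qed.

Definition row_repl n (A : 'M[R]_n) (a : 'I_n) (v : 'I_n -> R) : 'M[R]_n :=
  \matrix_(i, j) if i == a then v j else A i j.

Lemma derivation_prod (n : nat) (F : 'I_n -> R) :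
  D (\prod_i F i) = \sum_a \prod_i (if i == a then D (F i) else F i).
Proof.
elim: n F => [|n IH] F; first by rewrite !big_ord0 derivation1.
rewrite big_ord_recl DM IH big_ord_recl big_ord_recl /=; congr (_ + _).
rewrite mulr_sumr; apply: eq_bigr => a _; rewrite big_ord_recl /=; congr (_ * _).
Qed.

Lemma derivation_det n (A : 'M[R]_n) :
  D (\det A) = \sum_a \det (row_repl A a (fun j => D (A a j))).
Proof.
rewrite derivation_sum exchange_big /=; apply: eq_bigr => s _.
rewrite derivation_signr derivation_prod mulr_sumr; apply: eq_bigr => a _.
congr (_ * _); apply: eq_bigr => i _; rewrite mxE.
by case: eqP => // ->.
Qed.

(** Jacobi's formula [D (\det A) = \tr (\adj A *m D A)], combined with the
    cyclicity of the trace and [A *m \adj A = (\det A)%:M]. *)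
Lemma derivation_det_eigen n (A N N' : 'M[R]_n) :
  map_mx D A = N *m A + A *m N' -> D (\det A) = (\tr N + \tr N') * \det A.
Proof.
move=> eDA.
have -> : D (\det A) = \tr (map_mx D A *m \adj A).
  rewrite derivation_det; apply: eq_bigr => a _.
  rewrite mxE (expand_det_row _ a); apply: eq_bigr => j _.
  rewrite !mxE eqxx; congr (_ * _); rewrite /cofactor; congr (_ * \det _).
  by apply/matrixP => i l; rewrite !mxE eq_sym (negPf (neq_lift _ _)).
rewrite eDA mulmxDl mxtraceD -mulmxA mul_mx_adj mul_mx_scalar mxtraceZ.
rewrite mxtrace_mulC mulmxA mul_adj_mx mul_scalar_mx mxtraceZ.
by rewrite mulrDl ![_ * \det A]mulrC.
Qed.

Definition eigen (c : nat) (p : R) : Prop := D p = p *+ c.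

Lemma eigen1 : eigen 0 1.
Proof. by rewrite /eigen derivation1 mulr0n. Qed.

Lemma eigenM c c' p q : eigen c p -> eigen c' q -> eigen (c + c') (p * q).
Proof. by rewrite /eigen DM => -> ->; rewrite mulrnDr mulrnAl mulrnAr. Qed.

Lemma eigenX c p e : eigen c p -> eigen (c * e) (p ^+ e).
Proof.
move=> hp; elim: e => [|e IH]; first by rewrite muln0 expr0; exact: eigen1.
by rewrite exprS mulnS; exact: eigenM.
Qed.

Lemma eigen_prod I (r : seq I) (P : pred I) (c : I -> nat) F :
  (forall i, P i -> eigen (c i) (F i)) ->
  eigen (\sum_(i <- r | P i) c i) (\prod_(i <- r | P i) F i).
Proof.
by move=> h; apply: (big_ind2 eigen) => //; [exact: eigen1 | move=> *; exact: eigenM].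
Qed.

End Derivations.

Lemma det_row_repl_swap (R : comNzRingType) n (A : 'M[R]_n) a b (v w : 'I_n -> R) :
  a != b ->
  \det (row_repl (row_repl A a v) b w) = - \det (row_repl (row_repl A a w) b v).
Proof.
move=> neq; have -> : row_repl (row_repl A a v) b w
    = xrow a b (row_repl (row_repl A a w) b v).
  apply/matrixP => i j; rewrite !mxE.
  by case: tpermP => [->|->|/eqP nia /eqP nib]; rewrite ?eqxx ?(negPf neq)
    ?(negPf nia) ?(negPf nib).
rewrite xrowE det_mulmx.
by rewrite det_perm odd_tperm neq expr1 mulN1r.
Qed.

(** * The Fischer form and spans of polynomials *)

Section Fischer.
Variables (C : numFieldType) (N : nat).
Implicit Types p q : {mpoly C[N]}.

Definition mfact (m : 'X_{1..N}) : nat := \prod_i (m i)`!.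

Definition fischer p q : C := \sum_(m <- msupp p) p@_m * q@_m * (mfact m)%:R.

Lemma fischer_big (s : seq 'X_{1..N}) p q : uniq s -> {subset msupp p <= s} ->
  fischer p q = \sum_(m <- s) p@_m * q@_m * (mfact m)%:R.
Proof.
move=> us sub; rewrite [RHS](bigID (mem (msupp p))) /= [X in _ + X]big1 ?addr0.
  rewrite -[RHS]big_filter; apply: perm_big; apply: uniq_perm => //.
    exact: filter_uniq.
  by move=> m; rewrite mem_filter; case: (boolP (m \in msupp p)) => // /sub ->.
by move=> m /memN_msupp_eq0 ->; rewrite !mul0r.
Qed.

Lemma fischerC p q : fischer p q = fischer q p.
Proof.
pose s := undup (msupp p ++ msupp q).
rewrite !(@fischer_big s) ?undup_uniq //.
- by apply: eq_bigr => m _; rewrite [p@_m * _]mulrC.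
- by move=> m hm; rewrite mem_undup mem_cat hm orbT.
- by move=> m hm; rewrite mem_undup mem_cat hm.
Qed.

Lemma fischerDl p p' q : fischer (p + p') q = fischer p q + fischer p' q.
Proof.
pose s := undup (msupp p ++ msupp p').
rewrite !(@fischer_big s) ?undup_uniq //.
- by rewrite -big_split; apply: eq_bigr => m _ /=; rewrite mcoeffD !mulrDl.
- by move=> m hm; rewrite mem_undup mem_cat hm orbT.
- by move=> m hm; rewrite mem_undup mem_cat hm.
- by move=> m /msuppD_le; rewrite mem_undup.
Qed.

Lemma fischerZl c p q : fischer (c *: p) q = c * fischer p q.
Proof.
rewrite (@fischer_big (msupp p)) ?msupp_uniq //; last by move=> m /msuppZ_le.
by rewrite mulr_sumr; apply: eq_bigr => m _; rewrite mcoeffZ !mulrA.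
Qed.

Lemma fischer0l q : fischer 0 q = 0.
Proof. by rewrite -(scale0r (0 : {mpoly C[N]})) fischerZl mul0r. Qed.

Lemma fischer_suml I (r : seq I) (P : pred I) F q :
  fischer (\sum_(i <- r | P i) F i) q = \sum_(i <- r | P i) fischer (F i) q.
Proof.
exact: (big_morph (fun x => fischer x q) (fun p p' => fischerDl p p' q) (fischer0l q)).
Qed.

Lemma fischerZr c p q : fischer p (c *: q) = c * fischer p q.
Proof. by rewrite fischerC fischerZl fischerC. Qed.

Lemma fischer_sumr I (r : seq I) (P : pred I) F p :
  fischer p (\sum_(i <- r | P i) F i) = \sum_(i <- r | P i) fischer p (F i).
Proof. by rewrite fischerC fischer_suml; apply: eq_bigr => i _; rewrite fischerC. Qed.

Lemma fischerXl m q : fischer 'X_[m] q = q@_m * (mfact m)%:R.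
Proof. by rewrite /fischer msuppX big_seq1 mcoeffX eqxx mul1r. Qed.

Lemma mfactD1 u m : mfact (m + U_(u)) = ((m u).+1 * mfact m)%N.
Proof.
rewrite /mfact (bigD1 u) //= [in RHS](bigD1 u) //= mnmDE mnm1E eqxx addn1 factS.
rewrite mulnA; congr (_ * _)%N; apply: eq_bigr => i ni.
by rewrite mnmDE mnm1E eq_sym (negPf ni) addn0.
Qed.

(** The weights [mfact] are there to make this adjunction hold; the adjunction
    between [polarization i j] and [polarization j i] follows from it. *)
Lemma fischer_mulX_deriv u p q : fischer ('X_u * p) q = fischer p (mderiv u q).
Proof.
elim/mpolyind: p => [|c m p _ _ IH]; first by rewrite mulr0 !fischer0l.
rewrite mulrDr !fischerDl IH -scalerAr !fischerZl; congr (_ * _ + _).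
rewrite -mpolyXD addmC !fischerXl mcoeff_deriv mfactD1 natrM.
by rewrite -[in RHS](mulr_natr _ (m u).+1) mulrA.
Qed.

(** The form is bilinear rather than Hermitian, so that complex polynomials can be
    isotropic; on real ones it is a sum of squares with positive weights. *)
Lemma fischer_self_neq0 p : (forall m, p@_m \is Num.real) -> p != 0 ->
  fischer p p != 0.
Proof.
move=> real_p; apply: contra => /eqP h.
have pos m : 0 <= p@_m * p@_m * (mfact m)%:R.
  by rewrite mulr_ge0 ?ler0n // -expr2 real_exprn_even_ge0 ?real_p.
apply/eqP; apply/mpolyP => m; rewrite mcoeff0; apply/eqP; apply: contraT => nz.
have hm : m \in msupp p by rewrite mcoeff_msupp.
move/eqP: h; rewrite /fischer psumr_eq0; last by move=> *; exact: pos.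
move/allP => /(_ m hm) /=; rewrite !mulf_eq0 orbb (negPf nz) /= pnatr_eq0.
have : (0 < mfact m)%N by apply: prodn_gt0 => i; exact: fact_gt0.
by case: (mfact m).
Qed.

(** The derivative of [p] along its leading monomial is a nonzero constant, which
    vanishes at no point. *)
Lemma taylor_eq0 (x : 'I_N -> C) p :
  (forall s, (foldr (@mderiv N C) p s).@[x] = 0) -> p = 0.
Proof.
move=> h; apply/eqP; apply: contraT => nz; pose m := mlead p.
have e : mderivm m p = (p@_m *+ \prod_(i < N) (m i)`!)%:MP.
  apply/mpolyP => m'; rewrite mcoeff_mderivm mcoeffC.
  have [->|nz'] := eqVneq m' 0%MM.
    rewrite addm0 mulr1; congr (_ *+ _); apply: eq_bigr => i _.
    by rewrite ffactnn.
  rewrite mulr0 mcoeff_gt_mlead ?mul0rn //.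
  by rewrite -[X in (X < _)%O]addm0 ltmc_add2r lt_def nz' le0x.
have := h (flatten [seq nseq (m i) i | i <- enum 'I_N]).
rewrite -mderivm_foldr e mevalC => /eqP.
rewrite mulrn_eq0 mleadc_eq0 (negPf nz) orbF.
by rewrite -leqn0 leqNgt prodn_gt0 // => i; rewrite fact_gt0.

Qed.

(** A row space of maximal rank inside [Q] fills [Q], since adding an element of
    [Q] to it cannot increase its rank. *)
Lemma subspace_rowspace M (Q : 'rV[C]_M -> Prop) :
  Q 0 -> (forall u v, Q u -> Q v -> Q (u + v)) -> (forall c u, Q u -> Q (c *: u)) ->
  exists E : 'M[C]_M, forall u, Q u <-> (u <= E)%MS.
Proof.
move=> Q0 QD QZ.
pose good (E : 'M[C]_M) := forall u : 'rV_M, (u <= E)%MS -> Q u.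
pose pr r := `[< exists2 E, good E & \rank E = r >].
have ex0 : exists r, pr r.
  exists 0%N; apply/asboolP; exists 0; last exact: mxrank0.
  by move=> u; rewrite submx0 => /eqP ->.
have bd r : pr r -> (r <= M)%N by case/asboolP => E _ <-; exact: rank_leq_row.
case: (ex_maxnP ex0 bd) => r /asboolP[E gE rE] maxr.
exists E => u; split; last exact: gE.
move=> Qu; have gEu : good (E + u)%MS.
  move=> v /sub_addsmxP[[a b] /= ->]; apply: QD; first by apply: gE; exact: submxMl.
  by rewrite [b]mx11_scalar mul_scalar_mx; apply: QZ.
have le : (\rank (E + u)%MS <= \rank E)%N 
  by rewrite rE; apply: maxr; apply/asboolP; exists (E + u)%MS.
apply: (submx_trans (addsmxSr E u)).
by have [_ <-] := mxrank_leqif_sup (addsmxSl E u); rewrite eqn_leq le mxrankS // addsmxSl.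
Qed.

Definition lincomb (S : seq {mpoly C[N]}) (c : 'rV[C]_(size S)) : {mpoly C[N]} :=
  \sum_i c 0 i *: S`_i.

Definition in_span (S : seq {mpoly C[N]}) p : Prop := exists c, p = @lincomb S c.

Lemma lincombD S c c' : @lincomb S (c + c') = lincomb c + lincomb c'.
Proof. by rewrite -big_split; apply: eq_bigr => i _; rewrite mxE scalerDl. Qed.

Lemma lincombZ S a c : @lincomb S (a *: c) = a *: lincomb c.
Proof. by rewrite scaler_sumr; apply: eq_bigr => i _; rewrite mxE scalerA. Qed.

Lemma lincomb0 S : @lincomb S 0 = 0.
Proof. by rewrite -(scale0r 0) lincombZ scale0r. Qed.

Lemma in_spanD S p q : in_span S p -> in_span S q -> in_span S (p + q).
Proof. by move=> [c ->] [c' ->]; exists (c + c'); rewrite lincombD. Qed.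

Lemma in_spanZ S a p : in_span S p -> in_span S (a *: p).
Proof. by move=> [c ->]; exists (a *: c); rewrite lincombZ. Qed.

Lemma in_span0 S : in_span S 0.
Proof. by exists 0; rewrite lincomb0. Qed.

Lemma in_span_sum S I (r : seq I) (P : pred I) F :
  (forall i, P i -> in_span S (F i)) -> in_span S (\sum_(i <- r | P i) F i).
Proof. by move=> h; apply: big_ind => //; [exact: in_span0 | exact: in_spanD]. Qed.

Lemma mem_in_span S p : p \in S -> in_span S p.
Proof.
move=> hp; have lt : (index p S < size S)%N by rewrite index_mem.
exists (delta_mx 0 (Ordinal lt)); rewrite /lincomb (bigD1 (Ordinal lt)) //= mxE !eqxx.
rewrite scale1r nth_index // big1 ?addr0 // => i ni.
by rewrite mxE (negPf ni) andbF scale0r.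
Qed.

Lemma in_span_ind S (P : {mpoly C[N]} -> Prop) :
  P 0 -> (forall p q, P p -> P q -> P (p + q)) -> (forall c p, P p -> P (c *: p)) ->
  (forall p, p \in S -> P p) -> forall p, in_span S p -> P p.
Proof.
move=> P0 PD PZ PS p [c ->]; apply: big_ind => // i _.
by apply: PZ; apply: PS; apply: mem_nth.
Qed.

(** In finite dimension a subspace [P] of [V] whose orthogonal in [V] is zero
    is all of [V], by comparison of dimensions.  The generators [S] of [V] may
    be linearly dependent: their relations form the kernel of the Gram matrix
    of [S], which is cut out on both sides of the count. *)
Lemma orthogonal0_span S (P : {mpoly C[N]} -> Prop) :
  P 0 -> (forall p q, P p -> P q -> P (p + q)) -> (forall c p, P p -> P (c *: p)) ->
  (forall p, P p -> in_span S p) ->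
  (forall w, in_span S w -> (forall p, P p -> fischer w p = 0) -> w = 0) ->
  forall w, in_span S w -> P w.
Proof.
move=> P0 PD PZ PS orth.
pose G : 'M[C]_(size S) := \matrix_(i, j) fischer S`_i S`_j.
have GE c c' : fischer (lincomb c) (lincomb c') = (c *m G *m c'^T) 0 0.
  rewrite fischer_sumr mxE; apply: eq_bigr => j _.
  rewrite fischerZr fischer_suml !mxE mulrC; congr (_ * _).
  by apply: eq_bigr => i _; rewrite fischerZl mxE.
have GT : G^T = G by apply/matrixP => i j; rewrite !mxE fischerC.
have [E hE] : exists E : 'M[C]_(size S), forall u, P (lincomb u) <-> (u <= E)%MS.
  apply: subspace_rowspace => [|u v|c u]; rewrite ?lincomb0 ?lincombD ?lincombZ //.
    exact: PD.
  exact: PZ.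
have orth0 (c : 'rV_(size S)) : c *m G *m E^T = 0 -> c *m G = 0.
  move=> h; have -> : c *m G = \row_j fischer (lincomb c) S`_j.
    apply/rowP => j; rewrite !mxE fischer_suml.
    by apply: eq_bigr => i _; rewrite fischerZl mxE.
  rewrite (orth (lincomb c)); first by apply/rowP => j; rewrite !mxE fischer0l.
    by exists c.
  move=> p Pp; have [c' e] := PS p Pp; rewrite e GE.
  have /hE/submxP[D ->] : P (lincomb c') by rewrite -e.
  by rewrite trmx_mul mulmxA h mul0mx mxE.
have kerE : (kermx G <= E)%MS.
  apply/row_subP => i; apply/hE; suff -> : lincomb (row i (kermx G)) = 0 by [].
  apply: orth; first by exists (row i (kermx G)).
  move=> p /PS [c ->]; rewrite GE.
  by rewrite -row_mul mulmx_ker row0 mul0mx mxE.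
have rkGE : \rank (E *m G) = \rank G.
  have kk : (kermx (G *m E^T) :=: kermx G)%MS.
    apply/eqmxP/andP; split; apply/row_subP => i; apply/sub_kermxP.
      apply: orth0; apply/sub_kermxP.
      by rewrite sub_kermx -mulmxA -row_mul mulmx_ker row0.
    by rewrite mulmxA -row_mul mulmx_ker row0 mul0mx.
  have := mxrank_ker (G *m E^T); rewrite kk mxrank_ker.
  rewrite -[\rank (G *m E^T)]mxrank_tr trmx_mul trmxK GT.
  have := rank_leq_row G; have := rank_leq_row (E *m G).
  by move: (\rank G) (\rank (E *m G)) => r r'; clear; lia.
have := mxrank_mul_ker E G; rewrite rkGE.
have -> : \rank (E :&: kermx G)%MS = \rank (kermx G).
  by apply: eqmx_rank; rewrite capmxSr sub_capmx kerE submx_refl.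
rewrite mxrank_ker subnKC ?rank_leq_row // => rE w [c ->]; apply/hE.
by apply: submx_full; rewrite /row_full -rE.
Qed.

End Fischer.

(** * Products of row minors and the module generated by the bottom one *)

Lemma entry_ord (R : nmodType) m n (A : 'M[R]_(m, n)) i j (hi : (i < m)%N)
    (hj : (j < n)%N) : entry A i j = A (Ordinal hi) (Ordinal hj).
Proof. by rewrite /entry !insubT. Qed.

Lemma entry_ge_row (R : nmodType) m n (A : 'M[R]_(m, n)) i j :
  (m <= i)%N -> entry A i j = 0.
Proof. by move=> h; rewrite /entry insubF // ltnNge h. Qed.

Lemma entry_ge_col (R : nmodType) m n (A : 'M[R]_(m, n)) i j :
  (n <= j)%N -> entry A i j = 0.
Proof.
move=> h; rewrite /entry; case: insubP => // i' _ _.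
by rewrite insubF // ltnNge h.
Qed.

Section Minors.
Variables (C : numFieldType) (n k : nat).
Local Notation P := {mpoly C[k * n]}.
Local Notation X := (xmx C n k).

Lemma mderiv_derivation u : derivation (@mderiv (k * n) C u).
Proof. by split=> p q; rewrite ?mderivD ?mderivM. Qed.

Lemma mderivXU (u v : 'I_(k * n)) : mderiv u ('X_v : P) = (u == v)%:R.
Proof.
rewrite mderivX mnm1E eq_sym.
by case: eqP => [->|]; rewrite ?scale0r // subUm0 mpolyX0 scale1r.
Qed.

Lemma mxvec_index_eq (i i' : 'I_k) (l l' : 'I_n) :
  (mxvec_index i l == mxvec_index i' l') = (i == i') && (l == l').
Proof. by rewrite (inj_eq (@cast_ord_inj _ _ _)) (inj_eq enum_rank_inj) xpair_eqE. Qed.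

Lemma mxvec_indexK (u : 'I_(k * n)) : exists i l, u = mxvec_index i l.
Proof. by case/mxvec_indexP: u => i l; exists i, l. Qed.

Lemma dx_entry j l i l' :
  dx j l (entry X i l') = ((i == j :> nat) && (l' == l :> nat))%:R.
Proof.
have [hi|hi] := ltnP i k; last first.
  rewrite entry_ge_row // /dx mderiv0; case: eqP => // e.
  by move: hi; rewrite e leqNgt ltn_ord.
have [hl|hl] := ltnP l' n; last first.
  rewrite entry_ge_col // /dx mderiv0 andbC; case: eqP => // e.
  by move: hl; rewrite e leqNgt ltn_ord.
rewrite entry_ord mxE /dx mderivXU mxvec_index_eq -!(inj_eq val_inj) /=.
by rewrite ![(_ : nat) == val _]eq_sym.
Qed.

Lemma polarization_derivation i j : derivation (@polarization C n k i j).
Proof.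
split=> p q; rewrite /polarization.
  by rewrite -big_split; apply: eq_bigr => l _; rewrite /dx mderivD mulrDr.
rewrite mulr_suml mulr_sumr -big_split; apply: eq_bigr => l _ /=.
by rewrite /dx mderivM mulrDr; congr (_ + _); [rewrite mulrA | rewrite mulrCA].
Qed.

Lemma polarizationZ i j c p :
  @polarization C n k i j (c *: p) = c *: polarization i j p.
Proof.
rewrite scaler_sumr; apply: eq_bigr => l _.
by rewrite /dx mderivZ scalerAr.
Qed.

Lemma polarization_entry i j i' l :
  polarization i j (entry X i' l) = if i' == j :> nat then entry X i l else 0.
Proof.
rewrite /polarization; under eq_bigr do rewrite dx_entry.
case: eqP => [_|_]; last by rewrite big1 // => l' _; rewrite mulr0.
have [hl|hl] := ltnP l n; last first.
  rewrite entry_ge_col // big1 // => l' _; rewrite andTb.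
  by rewrite gtn_eqF ?mulr0 // (leq_trans (ltn_ord l')).
rewrite (bigD1 (Ordinal hl)) //= eqxx mulr1 big1 ?addr0.
  by rewrite (entry_ord _ (ltn_ord i) hl); congr (X _ _); apply: val_inj.
move=> l' nl; suff /negPf -> : (l != l' :> nat) by rewrite mulr0.
by apply: contra nl => /eqP e; apply/eqP/val_inj.
Qed.

Lemma fischer_polarization i j (p q : P) :
  fischer (polarization i j p) q = fischer p (polarization j i q).
Proof.
rewrite fischer_suml fischer_sumr; apply: eq_bigr => l _.
rewrite !mxE fischer_mulX_deriv fischerC [RHS]fischerC fischer_mulX_deriv.
by rewrite /dx fischerC.
Qed.

(** ** Row minors in the last columns *)

Definition rminor l (f : 'I_l -> 'I_k) : P :=
  \det (\matrix_(a < l, b < l) entry X (f a) (n - l + b)).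

Lemma eq_rminor l (f g : 'I_l -> 'I_k) : f =1 g -> rminor f = rminor g.
Proof. by move=> e; congr (\det _); apply/matrixP => a b; rewrite !mxE e. Qed.

Lemma polarization_rminor i j l (f : 'I_l -> 'I_k) :
  polarization i j (rminor f)
  = \sum_(a < l) if f a == j then rminor (fun c => if c == a then i else f c) else 0.
Proof.
rewrite derivation_det; last exact: polarization_derivation.
apply: eq_bigr => a _; rewrite -(inj_eq val_inj) /=.
case: eqP => [e|ne].
  congr (\det _); apply/matrixP => c b; rewrite !mxE.
  by case: (c == a) => //; rewrite polarization_entry e eqxx.
rewrite (expand_det_row _ a) big1 // => b _.
by rewrite mxE eqxx mxE polarization_entry; case: eqP ne => // _ _; rewrite mul0r.
Qed.

Lemma dx_rminor_eq0 i (c : 'I_n) l (f : 'I_l -> 'I_k) :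
  (c < n - l)%N -> dx i c (rminor f) = 0.
Proof.
move=> h; rewrite /dx (@derivation_det_eigen _ _ (mderiv_derivation _) _ _ 0 0).
  by rewrite mxtrace0 addr0 mul0r.
apply/matrixP => a b; rewrite mul0mx mulmx0 addr0 !mxE -/(dx i c _) dx_entry.
by rewrite [X in _ && X]gtn_eqF ?andbF // (leq_trans h) ?leq_addr.
Qed.

(** The Euler operator of the grading in which [x_il] has degree [i]. *)
Definition row_weight (p : P) : P := \sum_(i < k) polarization i i p *+ i.

Lemma row_weight_derivation : derivation row_weight.
Proof.
split=> p q; rewrite /row_weight.
  rewrite -big_split; apply: eq_bigr => i _ /=.
  by rewrite (polarization_derivation i i).1 mulrnDl.
rewrite mulr_suml mulr_sumr -big_split; apply: eq_bigr => i _ /=.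
by rewrite (polarization_derivation i i).2 mulrnDl mulrnAl mulrnAr.
Qed.

Lemma row_weight_entry i l : row_weight (entry X i l) = entry X i l *+ i.
Proof.
rewrite /row_weight; under eq_bigr do rewrite polarization_entry.
have [hi|hi] := ltnP i k; last first.
  rewrite [in RHS]entry_ge_row // mul0rn big1 // => j _.
  by rewrite gtn_eqF ?mul0rn // (leq_trans (ltn_ord j)).
rewrite (bigD1 (Ordinal hi)) //= eqxx big1 ?addr0 // => j nj.
suff /negPf -> : (i != j :> nat) by rewrite mul0rn.
by apply: contra nj => /eqP e; apply/eqP/val_inj.
Qed.

Lemma row_weightZ c p : row_weight (c *: p) = c *: row_weight p.
Proof.
rewrite scaler_sumr; apply: eq_bigr => i _.
by rewrite polarizationZ scalerMnr.
Qed.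

Lemma fischer_row_weight p q : fischer (row_weight p) q = fischer p (row_weight q).
Proof.
rewrite fischer_suml fischer_sumr; apply: eq_bigr => i _.
by rewrite -!scaler_nat fischerZl fischerZr fischer_polarization.
Qed.

Lemma eigen_rminor l (f : 'I_l -> 'I_k) : eigen row_weight (\sum_a f a) (rminor f).
Proof.
rewrite /eigen (@derivation_det_eigen _ _ row_weight_derivation _ _
  (diag_mx (\row_a (f a)%:R)) 0).
  rewrite mxtrace0 addr0 mxtrace_diag -mulr_natl natr_sum; congr (_ * _).
  by apply: eq_bigr => a _; rewrite mxE.
apply/matrixP => a b; rewrite mulmx0 addr0 mul_diag_mx !mxE row_weight_entry.
by rewrite mulr_natl.
Qed.

(** The matrix with an identity block in its bottom right corner. *)
Definition bottom_id : 'M[C]_(k, n) := \matrix_(i, l) (k - i == n - l)%N%:R.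

Definition evalmx (A : 'M[C]_(k, n)) (p : P) : C := p.@[fun u => mxvec A 0 u].

Lemma evalmx_entry A i l : evalmx A (entry X i l) = entry A i l.
Proof.
have [hi|hi] := ltnP i k; last by rewrite !entry_ge_row // /evalmx meval0.
have [hl|hl] := ltnP l n; last by rewrite !entry_ge_col // /evalmx meval0.
by rewrite !entry_ord /evalmx mxE mevalXU mxvecE.
Qed.

Lemma evalmx_det A l (M : 'M[P]_l) : evalmx A (\det M) = \det (map_mx (evalmx A) M).
Proof. by rewrite /evalmx -det_map_mx. Qed.

Lemma evalmx_minor A l (f : 'I_l -> 'I_k) :
  evalmx A (rminor f) = \det (\matrix_(a < l, b < l) entry A (f a) (n - l + b)).
Proof.
rewrite evalmx_det; congr (\det _); apply/matrixP => a b.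
by rewrite !mxE evalmx_entry.
Qed.

Lemma entry_bottom_id i l : (i < k)%N -> (l < n)%N ->
  entry bottom_id i l = (k - i == n - l)%N%:R.
Proof. by move=> hi hl; rewrite entry_ord mxE. Qed.

Lemma delta_minor_bottom_id l : (l <= n)%N -> (l <= k)%N ->
  evalmx bottom_id (delta_minor C n k l) = 1.
Proof.
move=> ln lk; rewrite evalmx_det -(det1 _ l); congr (\det _).
apply/matrixP => a b; have la := ltn_ord a; have lb := ltn_ord b.
rewrite !mxE evalmx_entry entry_bottom_id; [|lia..].
congr (nat_of_bool _)%:R; apply/eqP/eqP => [e|->]; last lia.
by apply: val_inj => /=; lia.
Qed.

Lemma eigen_delta_minor l : (l <= k)%N ->
  eigen row_weight (\sum_(a < l) (k - l + a)) (delta_minor C n k l).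
Proof.
move=> lk; have h (a : 'I_l) : (k - l + a < k)%N by have := ltn_ord a; lia.
exact: (eigen_rminor (fun a => Ordinal (h a))).
Qed.

(** Rows outside the last [l] have index less than [k - l], while the rows among
    the last [l] that they replace, in equal number, have index at least [k - l]. *)
Lemma sum_lt_bottom l (f : 'I_l -> 'I_k) (a : 'I_l) :
  injective f -> (l <= k)%N -> (f a < k - l)%N ->
  (\sum_a f a < \sum_(a < l) (k - l + a))%N.
Proof.
move=> injf lk fa.
pose B := [set i : 'I_k | (k - l <= i)%N]; pose I := [set f b | b : 'I_l].
have h (b : 'I_l) : (k - l + b < k)%N by have := ltn_ord b; lia.
have injh : injective (fun b => Ordinal (h b)).
  by move=> b c /(congr1 val) /= e; apply: val_inj => /=; lia.
have eB : B = [set Ordinal (h b) | b : 'I_l].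
  apply/setP => i; rewrite inE; apply/idP/imsetP => [hi|[b _ ->]] /=; last exact: leq_addr.
  have hb : (i - (k - l) < l)%N by have := ltn_ord i; lia.
  by exists (Ordinal hb) => //; apply: val_inj => /=; lia.
have sB : (\sum_(b < l) (k - l + b) = \sum_(i in B) i)%N.
  by rewrite eB big_imset //= => b c _ _ /injh.
have cB : #|B| = l by rewrite eB card_imset // card_ord.
have sI : (\sum_b f b = \sum_(i in I) i)%N by rewrite big_imset //= => b c _ _; exact: injf.
have cI : #|I| = l by rewrite card_imset // card_ord.
rewrite sB sI (big_setID B) [X in (_ < X)%N](big_setID I) /= finset.setIC ltn_add2l.
have cE : #|I :\: B| = #|B :\: I|.
  by have := cardsID B I; have := cardsID I B; rewrite finset.setIC; lia.
have aI : f a \in I :\: B by rewrite !inE -ltnNge fa imset_f.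
have le1 : (\sum_(i in I :\: B) i.+1 <= #|I :\: B| * (k - l))%N.
  rewrite -sum_nat_const; apply: leq_sum => i; rewrite !inE -ltnNge => /andP[//].
have le2 : (#|B :\: I| * (k - l) <= \sum_(i in B :\: I) i)%N.
  rewrite -sum_nat_const; apply: leq_sum => i; rewrite !inE => /andP[//].
apply: leq_trans le2; rewrite -cE; apply: leq_trans le1.
rewrite (bigD1 (f a)) //= [X in (_ < X)%N](bigD1 (f a)) //= addSn ltnS leq_add2l.
by apply: leq_sum => i _; exact: leqnSn.
Qed.

(** For a fixed size, evaluation at [bottom_id] and projection to the largest
    weight detect the same minors.  Repeated rows make the minor zero, which
    falls under the first alternative. *)
Lemma rminor_bottom l (f : 'I_l -> 'I_k) : (l <= n)%N -> (l <= k)%N ->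
  rminor f = evalmx bottom_id (rminor f) *: delta_minor C n k l
  \/ evalmx bottom_id (rminor f) = 0 /\ (\sum_a f a < \sum_(a < l) (k - l + a))%N.
Proof.
move=> ln lk; case: (pselect (exists a, (f a < k - l)%N)) => [[a fa]|nex].
  have z : evalmx bottom_id (rminor f) = 0.
    rewrite evalmx_minor (expand_det_row _ a) big1 // => b _; rewrite mxE entry_bottom_id //.
      rewrite gtn_eqF ?mul0r //; have := ltn_ord b; lia.
    by have := ltn_ord b; lia.
  have [/injectiveP inj|] := boolP (injectiveb f).
    by right; split=> //; exact: (@sum_lt_bottom _ _ a).
  case/injectivePn => b [c nbc fbc]; left; rewrite z scale0r.
  by apply: (determinant_alternate nbc) => j; rewrite !mxE fbc.
have fb a : (k - l <= f a)%N by rewrite leqNgt; apply/negP => h; apply: nex; exists a.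
have hg (a : 'I_l) : (f a - (k - l) < l)%N by have := fb a; have := ltn_ord (f a); lia.
pose T : 'M[C]_l := \matrix_(a, b) (Ordinal (hg a) == b)%:R.
have e : rminor f = (\det T) *: delta_minor C n k l.
  rewrite -mul_mpolyC -det_map_mx -det_mulmx; congr (\det _).
  apply/matrixP => a b; rewrite !mxE (bigD1 (Ordinal (hg a))) //= !mxE eqxx mul1r.
  rewrite big1 ?addr0 => [|c nc]; first by congr entry; rewrite /= subnKC ?fb.
  by rewrite !mxE eq_sym (negPf nc) mpolyC0 mul0r.
left; rewrite {1}e; congr (_ *: _).
by rewrite e /evalmx mevalZ -/(evalmx _ _) delta_minor_bottom_id ?mulr1.
Qed.

End Minors.

Section MinorProducts.
Variables (C : numFieldType) (n k : nat).
Local Notation P := {mpoly C[k * n]}.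
Local Notation X := (xmx C n k).
Local Notation bottom_id := (bottom_id C n k).

Definition rminors (l : nat) : seq P :=
  codom (fun f : {ffun 'I_l -> 'I_k} => rminor C n f).

Fixpoint minor_products (L : seq nat) : seq P :=
  if L is l :: L' then [seq f * w | f <- rminors l, w <- minor_products L']
  else [:: 1].

Definition delta_prod (L : seq nat) : P := \prod_(l <- L) delta_minor C n k l.

Definition bottom_weight (L : seq nat) : nat :=
  (\sum_(l <- L) \sum_(a < l) (k - l + a))%N.

Lemma mem_rminors l (f : 'I_l -> 'I_k) : rminor C n f \in rminors l.
Proof.
apply/codomP; exists [ffun a => f a].
by apply: eq_rminor => a; rewrite ffunE.
Qed.

Lemma in_span_minor_products l L p q :
  p \in rminors l -> in_span (minor_products L) q ->
  in_span (minor_products (l :: L)) (p * q).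
Proof.
move=> hp; elim/in_span_ind: q / => [|q q' hq hq'|c q hq|q hq].
- by rewrite mulr0; exact: in_span0.
- by rewrite mulrDr; exact: in_spanD.
- by rewrite -scalerAr; exact: in_spanZ.
by apply/mem_in_span/allpairsP; exists (p, q).
Qed.

Lemma polarization_span L i j p :
  in_span (minor_products L) p -> in_span (minor_products L) (polarization i j p).
Proof.
have [PD PM] := polarization_derivation C n i j.
have P0 : polarization i j (0 : P) = 0 by apply: derivation0.
have P1 : polarization i j (1 : P) = 0 by apply: derivation1.
elim/in_span_ind: p / => [|p q hp hq|c p hp|].
- by rewrite P0; exact: in_span0.
- by rewrite PD; exact: in_spanD.
- by rewrite polarizationZ; exact: in_spanZ.
elim: L => [|l L IH] p /=; first by rewrite inE => /eqP ->; rewrite P1; exact: in_span0.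
case/allpairsP => -[f w] /= [hf hw ->]; rewrite PM; apply: in_spanD.
  case/codomP: hf => g ->; rewrite polarization_rminor mulr_suml.
  apply: in_span_sum => a _; case: eqP => _; last by rewrite mul0r; exact: in_span0.
  by apply: in_span_minor_products; [exact: mem_rminors | exact: mem_in_span].
by apply: in_span_minor_products => //; exact: IH.
Qed.

Definition bounded (L : seq nat) : bool := all (fun l => l <= minn n k)%N L.

Lemma boundedP l L : bounded (l :: L) -> [/\ (l <= n)%N, (l <= k)%N & bounded L].
Proof. by rewrite /bounded /= leq_min => /andP[/andP[]]. Qed.

Lemma delta_prod_bottom_id L : bounded L -> evalmx bottom_id (delta_prod L) = 1.
Proof.
rewrite /evalmx rmorph_prod /=; elim: L => [|l L IH]; first by rewrite big_nil.
case/boundedP => ln lk hL; rewrite big_cons IH // mulr1.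
exact: delta_minor_bottom_id.
Qed.

Lemma delta_prod_span L : bounded L -> in_span (minor_products L) (delta_prod L).
Proof.
rewrite /delta_prod; elim: L => [_|l L IH].
  by rewrite big_nil; apply: mem_in_span; rewrite inE.
case/boundedP => ln lk hL; rewrite big_cons; apply: in_span_minor_products; last exact: IH.
have h (a : 'I_l) : (k - l + a < k)%N by have := ltn_ord a; lia.
exact: (mem_rminors (fun a => Ordinal (h a))).
Qed.

Lemma eigen_delta_prod L : bounded L ->
  eigen (@row_weight C n k) (bottom_weight L) (delta_prod L).
Proof.
rewrite /delta_prod /bottom_weight; elim: L => [_|l L IH].
  by rewrite !big_nil; apply: eigen1; exact: row_weight_derivation.
case/boundedP => ln lk hL.
rewrite !big_cons; apply: eigenM; [exact: row_weight_derivation| |exact: IH].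
exact: eigen_delta_minor.
Qed.

Lemma eigen_row_weightZ e c p : eigen (@row_weight C n k) e p ->
  eigen (@row_weight C n k) e (c *: p).
Proof. by rewrite /eigen row_weightZ => ->; rewrite scalerMnr. Qed.

(** The bottom rows are the unique choice of maximal weight in each factor. *)
Lemma minor_products_weight L w : bounded L -> w \in minor_products L ->
  w = evalmx bottom_id w *: delta_prod L
  \/ evalmx bottom_id w = 0
     /\ exists2 e, (e < bottom_weight L)%N & eigen (@row_weight C n k) e w.
Proof.
elim: L w => [w _|l L IH w].
  rewrite inE => /eqP ->; left.
  by rewrite /evalmx meval1 scale1r /delta_prod big_nil.
case/boundedP => ln lk hL.
have dW := row_weight_derivation C n k.
case/allpairsP => -[f w'] /= [+ hw ->] {w}.
rewrite /rminors => /codomP[g ->] {f}.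
have evM : evalmx bottom_id (rminor C n g * w')
    = evalmx bottom_id (rminor C n g) * evalmx bottom_id w'.
  by rewrite /evalmx mevalM.
rewrite evM /delta_prod /bottom_weight !big_cons -/(delta_prod L) -/(bottom_weight L).
have hd := eigen_delta_minor C n lk; have hd' := eigen_delta_prod hL.
have hg := eigen_rminor C n g.
case: (rminor_bottom C g ln lk) => [eg|[eg0 eg]];
  case: (IH w' hL hw) => [ew|[ew0 [e le hwe]]].
- by left; rewrite {1}eg {1}ew -scalerAl -scalerAr scalerA.
- right; rewrite ew0 mulr0; split=> //.
  exists (\sum_(a < l) (k - l + a) + e)%N; first by rewrite ltn_add2l.
  by apply: (eigenM dW) hwe; rewrite eg; exact: eigen_row_weightZ hd.
- right; rewrite eg0 mul0r; split=> //.
  exists (\sum_a g a + bottom_weight L)%N; first by rewrite ltn_add2r.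
  by apply: (eigenM dW) hg _; rewrite ew; exact: eigen_row_weightZ hd'.
right; rewrite eg0 mul0r; split=> //.
exists (\sum_a g a + e)%N; first by rewrite -addnS leq_add // ltnW.
exact: (eigenM dW) hg hwe.
Qed.

(** Eigenvectors of the self-adjoint operator [row_weight] for distinct
    eigenvalues are orthogonal, so pairing with [delta_prod L] only sees the
    component of largest weight, and so does evaluation at [bottom_id]. *)
Lemma fischer_delta_prod L w : bounded L -> in_span (minor_products L) w ->
  fischer w (delta_prod L) = evalmx bottom_id w * fischer (delta_prod L) (delta_prod L).
Proof.
move=> hL; elim/in_span_ind: w / => [|p q hp hq|c p hp|w hw].
- by rewrite fischer0l /evalmx meval0 mul0r.
- by rewrite fischerDl hp hq /evalmx mevalD mulrDl.
- by rewrite fischerZl hp /evalmx mevalZ mulrA.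
case: (minor_products_weight hL hw) => [{1}->|[-> [e le hwe]]].
  by rewrite fischerZl.
have := fischer_row_weight w (delta_prod L).
rewrite hwe eigen_delta_prod // mul0r -!scaler_nat fischerZl fischerZr => /eqP.
rewrite -subr_eq0 -mulrBl mulf_eq0 subr_eq0 eqr_nat => /orP[/eqP e'|/eqP //].
by rewrite e' ltnn in le.
Qed.

Lemma real_coeffsM (p q : P) : (forall m, p@_m \is Num.real) ->
  (forall m, q@_m \is Num.real) -> forall m, (p * q)@_m \is Num.real.
Proof. by move=> hp hq m; rewrite mcoeffM rpred_sum // => i _; exact: rpredM. Qed.

Lemma real_coeffs_prod I (r : seq I) (F : I -> P) :
  (forall i m, (F i)@_m \is Num.real) ->
  forall m, (\prod_(i <- r) F i)@_m \is Num.real.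
Proof.
move=> h; elim: r => [|i r IH] m; first by rewrite big_nil mcoeff1 realn.
by rewrite big_cons; apply: real_coeffsM.
Qed.

Lemma delta_prod_real L m : (delta_prod L)@_m \is Num.real.
Proof.
apply: real_coeffs_prod => l {}m; rewrite raddf_sum; apply: rpred_sum => s _ /=.
rewrite -signr_odd; case: (odd _); rewrite ?expr1 ?mulN1r ?mcoeffN ?rpredN ?mul1r;
  apply: real_coeffs_prod => a {}m; rewrite mxE /entry;
  (case: insub => [i|]; last by rewrite mcoeff0 rpred0);
  (case: insub => [j|]; last by rewrite mcoeff0 rpred0);
  by rewrite mxE mcoeffX realn.
Qed.

Lemma fischer_delta_prod_neq0 L : bounded L ->
  fischer (delta_prod L) (delta_prod L) != 0.
Proof.
move=> hL; apply: fischer_self_neq0; first by move=> m; exact: delta_prod_real.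
apply/eqP => e; have := delta_prod_bottom_id hL.
by rewrite e /evalmx meval0 => /eqP; rewrite eq_sym oner_eq0.
Qed.

(** ** Vanishing along the orbit of [bottom_id] *)

(** Moving derivatives past a polarization only creates derivatives of the same
    order, on which [vanish_on_orbit] can proceed by induction. *)
Lemma foldr_mderiv_polarization i j (s : seq 'I_(k * n)) (w : P) :
  exists2 ss, all (fun s' => size s' == size s) ss &
    foldr (@mderiv _ C) (polarization i j w) s
    = polarization i j (foldr (@mderiv _ C) w s)
      + \sum_(s' <- ss) foldr (@mderiv _ C) w s'.
Proof.
elim: s => [|u s [ss hss IH]] /=; first by exists [::] => //; rewrite big_nil addr0.
have [p [l eu]] := mxvec_indexK u.
exists ((if p == i then [:: mxvec_index j l :: s] else [::]) ++ [seq u :: s' | s' <- ss]).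
  rewrite all_cat all_map; apply/andP; split; first by case: ifP => //=; rewrite eqxx.
  exact: hss.
rewrite IH mderivD big_cat big_map addrA; congr (_ + _); last first.
  by rewrite raddf_sum.
set z := foldr _ w s.
rewrite /polarization raddf_sum addrC /=.
have -> : \sum_(s' <- if p == i then [:: mxvec_index j l :: s] else [::])
      foldr (@mderiv _ C) w s' = \sum_(l' < n) mderiv u (X i l') * dx j l' z.
  rewrite [in RHS](bigD1 l) //= [X in _ + X]big1 ?addr0.
    rewrite mxE mderivXU eu mxvec_index_eq eqxx andbT.
    by case: eqP => _; rewrite ?big_seq1 ?mul1r ?big_nil ?mul0r.
  move=> l' nl; rewrite mxE mderivXU eu mxvec_index_eq [l == l']eq_sym (negPf nl).
  by rewrite andbF mul0r.
rewrite -big_split; apply: eq_bigr => l' _ /=.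
by rewrite mderivM /dx mderiv_comm.
Qed.

(** At [bottom_id] the operators [polarization p q] with [p] among the last rows
    are the partial derivatives with respect to the last columns.  Hence, if a
    space stable under polarizations vanishes at [bottom_id], then so do, order
    by order, all the derivatives of its elements. *)
Lemma vanish_on_orbit (Q : P -> Prop) :
  (forall i j w, Q w -> Q (polarization i j w)) ->
  (forall w, Q w -> evalmx bottom_id w = 0) ->
  (forall w i (l : 'I_n), Q w -> (l < n - minn n k)%N -> dx i l w = 0) ->
  forall w, Q w -> w = 0.
Proof.
move=> Qpol Q0 Qcol w Qw.
pose x : 'I_(k * n) -> C := fun u => mxvec bottom_id 0 u.
apply: (taylor_eq0 (x := x)) => s.
have [r] := ubnP (size s); elim: r => // r IH in s w Qw *.
case: s => [_|u s]; first exact: Q0.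
rewrite ltnS => hs /=.
have [q [l eu]] := mxvec_indexK u.
have [hl|hl] := ltnP l (n - minn n k).
  have -> : mderiv u (foldr (@mderiv _ C) w s) = foldr (@mderiv _ C) (mderiv u w) s.
    by elim: (s) => //= v s' <-; rewrite mderiv_comm.
  rewrite eu -/(dx q l w) Qcol //.
  have -> : foldr (@mderiv _ C) (0 : P) s = 0 by elim: (s) => //= v s' ->; rewrite mderiv0.
  exact: meval0.
have hp : (k - (n - l) < k)%N by have := ltn_ord l; lia.
pose p := Ordinal hp.
have [ss hss e] := foldr_mderiv_polarization p q s w.
set z := foldr _ w s in e *.
have -> : mderiv u z = polarization p q z
    + \sum_(l' < n) ((l' == l)%:R - X p l') * dx q l' z.
  rewrite -big_split (bigD1 l) //= eqxx eu big1 ?addr0.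
    by rewrite -mulrDl addrC subrK mul1r.
  by move=> l' nl; rewrite (negPf nl) sub0r mulNr subrr.
have -> : polarization p q z = foldr (@mderiv _ C) (polarization p q w) s
    - \sum_(s' <- ss) foldr (@mderiv _ C) w s' by rewrite e addrK.
rewrite mevalD mevalB (IH s _ (Qpol p q w Qw) hs).
rewrite (big_morph (meval x) (mevalD x) (meval0 x)) big_seq big1 => [|s' hs']; last first.
  by apply: (IH _ _ Qw); move/allP: hss => /(_ s' hs') /eqP ->.
rewrite subr0 add0r (big_morph (meval x) (mevalD x) (meval0 x)) big1 //= => l' _.
rewrite mevalM mevalB rmorph_nat mxE mevalXU /x mxvecE mxE /=.
have -> : (k - (k - (n - l)) == n - l')%N = (l' == l).
  apply/eqP/eqP => [h|->]; last by have := ltn_ord l; lia.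
  by apply: val_inj => /=; have := ltn_ord l; have := ltn_ord l'; lia.
by rewrite subrr mul0r.
Qed.

Lemma dx_span_eq0 L i (c : 'I_n) w : bounded L -> (c < n - minn n k)%N ->
  in_span (minor_products L) w -> dx i c w = 0.
Proof.
move=> hL hc; rewrite /dx; elim/in_span_ind: w / => [|p q hp hq|a p hp|].
- exact: mderiv0.
- by rewrite mderivD hp hq addr0.
- by rewrite mderivZ hp scaler0.
elim: L hL => [_ w|l L IH /boundedP[ln lk hL] w] /=.
  by rewrite inE => /eqP ->; rewrite -mpolyC1 mderivC.
case/allpairsP => -[f w'] /= [+ hw ->].
rewrite /rminors => /codomP[g ->]; rewrite mderivM (IH hL _ hw) mulr0 addr0.
rewrite -/(dx i c _) dx_rminor_eq0 ?mul0r //; move: hc; lia.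
Qed.

(** An element [w] of the span orthogonal to the module generated by the
    bottom product is killed, together with all its polarizations, by the
    pairing with that product, that is, vanishes at [bottom_id].  As the orbit of
    [bottom_id] is dense in the space of the last [minn n k] columns, on which
    alone [w] depends, [w] is zero. *)
Theorem minor_products_generated L w : bounded L ->
  in_span (minor_products L) w -> k_submodule_gen (delta_prod L) w.
Proof.
move=> hL; pose F := k_submodule_gen (delta_prod L).
have hopE i j (p : P) : hop i j p = polarization i j p + (n%:R / 2 * (i == j)%:R) *: p by [].
apply: (@orthogonal0_span _ _ _ F) => [|p q|c p|p|{}w hw orth].
- by rewrite -(scale0r (delta_prod L)); apply/kgen_scale/kgen_base.
- exact: kgen_add.
- exact: kgen_scale.
- elim=> {p} [|p q _ hp _ hq|c p _ hp|i j p _ hp].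
  + exact: delta_prod_span.
  + exact: in_spanD.
  + exact: in_spanZ.
  + by rewrite hopE; apply: in_spanD; [exact: polarization_span | exact: in_spanZ].
pose Q w := in_span (minor_products L) w /\ forall p, F p -> fischer w p = 0.
apply: (@vanish_on_orbit Q) => [i j {}w {orth hw} [hw orth]|{}w {orth hw} [hw orth]
                               |{}w i l {orth hw} [hw orth] hl|].
- split=> [|p Fp]; first exact: polarization_span.
  rewrite fischer_polarization.
  have -> : polarization j i p = hop j i p + (- (n%:R / 2 * (j == i)%:R)) *: p.
    by rewrite hopE scaleNr addrK.
  by apply: orth; apply: kgen_add; [exact: kgen_act | exact: kgen_scale].
- have := orth _ (kgen_base _); rewrite fischer_delta_prod // => /eqP.
  by rewrite mulf_eq0 (negPf (fischer_delta_prod_neq0 hL)) orbF => /eqP.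
- exact: dx_span_eq0 hw.
by [].
Qed.

End MinorProducts.

(** * Harmonicity *)

Section Harmonic.
Variables (C : numFieldType) (n k : nat).
Local Notation P := {mpoly C[k * n]}.
Local Notation X := (xmx C n k).

(** The second derivatives of a minor are antisymmetric in the two columns
    concerned, over which the Laplacian sums symmetrically. *)
Lemma Laplacian_rminor i j l (f : 'I_l -> 'I_k) : Laplacian i j (rminor C n f) = 0.
Proof.
have eqr (M : 'M[P]_l) a v w : v =1 w -> row_repl M a v = row_repl M a w.
  by move=> vw; apply/matrixP => x y; rewrite !mxE vw.
have rowE (M : 'M[P]_l) a v x y : row_repl M a v x y = if x == a then v y else M x y.
  by rewrite mxE.
set A := \matrix_(a < l, b < l) entry X (f a) (n - l + b).
pose e (c : 'I_n) (q : 'I_l) : P := (n - l + q == c)%N%:R.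
pose T c' c := \sum_b \sum_(a | a != b) ((f b == j) && (f a == i))%:R
    * \det (row_repl (row_repl A b (e c)) a (e c')).
have dA i' c a q : dx i' c (A a q) = (f a == i')%:R * e c q.
  by rewrite mxE dx_entry (inj_eq val_inj) -natrM mulnb.
have row0 (M : 'M[P]_l) a : \det (row_repl M a (fun _ => 0)) = 0.
  by rewrite (expand_det_row _ a) big1 // => q _; rewrite mxE eqxx mul0r.
have repl0 (M : 'M[P]_l) a (b : bool) v :
    \det (row_repl M a (fun q => b%:R * v q)) = b%:R * \det (row_repl M a v).
  case: b; last first.
    by rewrite mul0r -[RHS](row0 M a); congr (\det _); apply: eqr => q; rewrite mul0r.
  by rewrite mul1r; congr (\det _); apply/matrixP => x y; rewrite !mxE mul1r.
have TE c' c : dx i c' (dx j c (rminor C n f)) = T c' c.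
  rewrite /dx (derivation_det (mderiv_derivation _ _)) raddf_sum; apply: eq_bigr => b _ /=.
  have -> : row_repl A b (fun q => mderiv (mxvec_index j c) (A b q))
      = row_repl A b (fun q => (f b == j)%:R * e c q).
    by apply: eqr => q; exact: dA.
  rewrite repl0 mderivM.
  have -> : mderiv (mxvec_index i c') (f b == j)%:R = 0 :> P.
    by case: (f b == j); rewrite ?mderiv0 // -mpolyC1 mderivC.
  rewrite mul0r add0r (derivation_det (mderiv_derivation _ _)) (bigD1 b) //=.
  have -> : row_repl (row_repl A b (e c)) b
      (fun q => mderiv (mxvec_index i c') (row_repl A b (e c) b q))
      = row_repl (row_repl A b (e c)) b (fun _ => 0).
    apply: eqr => q; rewrite rowE eqxx /e.
    by case: (_ == _); rewrite ?mderiv0 // -mpolyC1 mderivC.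
  rewrite row0 add0r mulr_sumr; apply: eq_bigr => a nab.
  have -> : row_repl (row_repl A b (e c)) a
      (fun q => mderiv (mxvec_index i c') (row_repl A b (e c) a q))
      = row_repl (row_repl A b (e c)) a (fun q => (f a == i)%:R * e c' q).
    by apply: eqr => q; rewrite rowE (negPf nab); exact: dA.
  by rewrite repl0 mulrA -natrM mulnb.
have Tanti c' c : T c' c = - T c c'.
  rewrite /T -sumrN; apply: eq_bigr => b _; rewrite -sumrN; apply: eq_bigr => a nab.
  by rewrite det_row_repl_swap 1?eq_sym // mulrN.
have e2 : Laplacian i j (rminor C n f) = - Laplacian i j (rminor C n f).
  have LE : Laplacian i j (rminor C n f) = \sum_c T c (rev_ord c).
    by apply: eq_bigr => c _; exact: TE.
  rewrite {1}LE (reindex_inj rev_ord_inj) LE -sumrN /=.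
  by apply: eq_bigr => c _; rewrite rev_ordK Tanti.
apply/eqP; have : (2%:R : C) *: Laplacian i j (rminor C n f) == 0.
  by rewrite scaler_nat mulr2n {1}e2 addNr.
by rewrite scaler_eq0 pnatr_eq0.
Qed.

(** Of two complementary columns, either one lies before [n - d], and neither
    factor involves it, or both lie before [n - t], where [g] is a constant. *)
Lemma harmonic_rminor_mul d t (f : 'I_d -> 'I_k) (g : P) :
  (t <= d)%N -> (t + d <= n)%N ->
  (forall i (c : 'I_n), (c < n - t)%N -> dx i c g = 0) ->
  harmonics C n k (rminor C n f * g).
Proof.
move=> le_td le_tdn g0 i j.
suff -> : Laplacian i j (rminor C n f * g) = Laplacian i j (rminor C n f) * g.
  by rewrite Laplacian_rminor mul0r.
rewrite /Laplacian [RHS]mulr_suml;  apply: eq_bigr => c _.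
have f0 i' (c' : 'I_n) : (c' < n - d)%N -> dx i' c' (rminor C n f) = 0.
  exact: dx_rminor_eq0.
have dxM i' c' p q : dx i' c' (p * q) = dx i' c' p * q + p * dx i' c' q :> P.
  exact: mderivM.
have dx0 i' c' : dx i' c' (0 : P) = 0 by exact: mderiv0.
have dxC i' c' j' c'' p : dx i' c' (dx j' c'' p) = dx j' c'' (dx i' c' p) :> P.
  exact: mderiv_comm.
have hc : (rev_ord c = n - c.+1 :> nat)%N by [].
have lc := ltn_ord c.
have [h|h] := ltnP (rev_ord c) (n - t).
  rewrite (dxM j) (g0 j) // mulr0 addr0 dxM.
  have [h'|h'] := ltnP c (n - t); first by rewrite (g0 i) // mulr0 addr0.
  by rewrite (f0 j) ?mul0r ?dx0 ?mul0r ?addr0 //; lia.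
rewrite dxC dxM (f0 i); last by lia.
rewrite (g0 i); last by lia.
by rewrite mul0r mulr0 addr0 dx0 dxC (f0 i) ?dx0 ?mul0r //; lia.
Qed.

End Harmonic.

(** * The bordered matrix *)

Section Bordered.
Variables (C : numFieldType) (n k : nat).
Local Notation P := {mpoly C[k * n]}.
Local Notation X := (xmx C n k).
Local Notation M := (Mmx C n k).
Local Notation Mt := (Mmx_tens C n k).

Definition tensl : P -> {mpoly C[k * n + k * n]} :=
  comp_mpoly [tuple 'X_(lshift (k * n) u) | u < k * n].
Definition tensr : P -> {mpoly C[k * n + k * n]} :=
  comp_mpoly [tuple 'X_(rshift (k * n) u) | u < k * n].

HB.instance Definition _ := GRing.RMorphism.on tensl.
HB.instance Definition _ := GRing.RMorphism.on tensr.

Lemma tensE p q : tens p q = tensl p * tensr q. Proof. by []. Qed.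
Lemma tens1r p : tens p 1 = tensl p. Proof. by rewrite tensE rmorph1 mulr1. Qed.
Lemma tens1l p : tens 1 p = tensr p. Proof. by rewrite tensE rmorph1 mul1r. Qed.

Lemma Mmx_blockE : M = block_mx (X *m antidiag _ n *m X^T) (X *m antidiag _ n)
                          (antidiag _ n *m X^T) (antidiag _ n).
Proof. by rewrite /Mmx mul_col_mx mul_col_row !mul1mx !mulmx1. Qed.

Lemma mul_antidiag (i : 'I_k) (l : 'I_n) :
  (X *m antidiag _ n) i l = X i (rev_ord l).
Proof.
rewrite mxE (bigD1 (rev_ord l)) //= [X in _ * X]mxE rev_ordK eqxx mulr1 big1 ?addr0 //.
move=> l' nl; rewrite [antidiag _ _ _ _]mxE -(inj_eq rev_ord_inj) rev_ordK eq_sym.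
by rewrite (negPf nl) mulr0.
Qed.

Lemma antidiag_mul (i : 'I_k) (l : 'I_n) :
  (antidiag _ n *m X^T) l i = X i (rev_ord l).
Proof.
have aT : (antidiag P n)^T = antidiag P n.
  apply/matrixP => a b; rewrite !mxE; congr (nat_of_bool _)%:R.
  by rewrite -(inj_eq rev_ord_inj) rev_ordK eq_sym.
by rewrite -mul_antidiag -{1}aT -trmx_mul mxE.
Qed.

Lemma entry_M_ur r l : (l < n)%N -> entry M r (k + l) =
  if (r < k)%N then entry X r (n.-1 - l)
  else if (r < k + n)%N then ((r - k) + l == n.-1)%N%:R else 0.
Proof.
move=> hl; have hkl : (k + l < k + n)%N by rewrite ltn_add2l.
have [hr|hr] := ltnP r k.
  have hr' : (r < k + n)%N by rewrite ltn_addr.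
  rewrite (entry_ord _ hr' hkl) Mmx_blockE.
  have -> : Ordinal hr' = lshift n (Ordinal hr) by apply: val_inj.
  have -> : Ordinal hkl = rshift k (Ordinal hl) by apply: val_inj.
  rewrite block_mxEur mul_antidiag.
  have hl' : (n.-1 - l < n)%N by lia.
  by rewrite (entry_ord _ hr hl'); congr (X _ _); apply: val_inj => /=; lia.
have [hr'|hr'] := ltnP r (k + n); last by rewrite entry_ge_row.
have hr2 : (r - k < n)%N by lia.
rewrite (entry_ord _ hr' hkl) Mmx_blockE.
have -> : Ordinal hr' = rshift k (Ordinal hr2) by apply: val_inj => /=; lia.
have -> : Ordinal hkl = rshift k (Ordinal hl) by apply: val_inj.
rewrite block_mxEdr mxE; congr (nat_of_bool _)%:R.
by rewrite -(inj_eq val_inj) /=; lia.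
Qed.

Lemma entry_M_dl l c : (l < n)%N -> (c < k)%N -> entry M (k + l) c = entry X c (n.-1 - l).
Proof.
move=> hl hc; have hkl : (k + l < k + n)%N by rewrite ltn_add2l.
have hc' : (c < k + n)%N by rewrite ltn_addr.
rewrite (entry_ord _ hkl hc') Mmx_blockE.
have -> : Ordinal hc' = lshift n (Ordinal hc) by apply: val_inj.
have -> : Ordinal hkl = rshift k (Ordinal hl) by apply: val_inj.
rewrite block_mxEdl antidiag_mul.
have hl' : (n.-1 - l < n)%N by lia.
by rewrite (entry_ord _ hc hl'); congr (X _ _); apply: val_inj => /=; lia.
Qed.

Lemma entry_Mt r c :
  entry Mt r c = if (r < k)%N && (c < k)%N then tensl (entry M r c) else tensr (entry M r c).
Proof.
have [hr|hr] := ltnP r (k + n); last by rewrite !entry_ge_row // !rmorph0 if_same.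
have [hc|hc] := ltnP c (k + n); last by rewrite !entry_ge_col // !rmorph0 if_same.
by rewrite !(entry_ord _ hr hc) mxE /= tens1r tens1l.
Qed.

Lemma entry_mul (R : comNzRingType) m p q (A : 'M[R]_(m, p)) (B : 'M_(p, q)) r c :
  entry (A *m B) r c = \sum_(l < p) entry A r l * entry B l c.
Proof.
have [hr|hr] := ltnP r m; last first.
  by rewrite entry_ge_row // big1 // => l _; rewrite entry_ge_row // mul0r.
have [hc|hc] := ltnP c q; last first.
  by rewrite entry_ge_col // big1 // => l _; rewrite [entry B _ _]entry_ge_col // mulr0.
rewrite (entry_ord _ hr hc) mxE; apply: eq_bigr => l _.
rewrite (entry_ord _ hr (ltn_ord l)) (entry_ord _ (ltn_ord l) hc).
by congr (A _ _ * B _ _); apply: val_inj.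
Qed.

Lemma det_submx_Mmx a b : \det (submx_at M n.+1 a b) = 0.
Proof.
rewrite -(det_low_rank
  (\matrix_(i < n.+1, l < n) entry (col_mx X 1%:M *m antidiag _ n) (a + i) l)
  (\matrix_(l < n, j < n.+1) entry (row_mx X^T 1%:M) l (b + j))).
congr (\det _); apply/matrixP => i j; rewrite !mxE entry_mul.
by apply: eq_bigr => l _; rewrite !mxE.
Qed.

Local Notation mulT := (comp_mpoly
  [tuple match split u with inl a => 'X_a | inr a => 'X_a end | u < k * n + k * n]).
Local Notation transT g := (comp_mpoly
  [tuple mxvec (X *m map_mx (@mpolyC _ _) g) 0 u | u < k * n]).

Lemma tens_mul_det_vector a b mu : tens_mul (det_vector C n k a b mu) = 0.
Proof.
have tml p : tens_mul (tensl p) = p by rewrite -tens1r tens_mul_tens mulr1.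
have tmr p : tens_mul (tensr p) = p by rewrite -tens1l tens_mul_tens mul1r.
rewrite /tens_mul rmorphM /= -det_map_mx.
suff -> : map_mx mulT (submx_at Mt n.+1 a.-1 b.-1)
          = submx_at M n.+1 a.-1 b.-1 by rewrite det_submx_Mmx mul0r.
by apply/matrixP => i j; rewrite !mxE entry_Mt; case: ifP => _; [exact: tml | exact: tmr].
Qed.

(** ** Invariants *)

Lemma translate_X (g : 'M[C]_n) (i : 'I_k) (l : 'I_n) :
  translate g (X i l) = (X *m map_mx (@mpolyC _ _) g) i l.
Proof.
rewrite /translate [X in X \mPo _]mxE comp_mpolyXU -tnth_nth tnth_mktuple.
exact: mxvecE.
Qed.

Lemma invariants_gram (i j : 'I_k) : invariants C n k ((X *m antidiag _ n *m X^T) i j).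
Proof.
move=> g hg; pose T := transT g.
have eJ : antidiag P n = map_mx (@mpolyC _ _) (antidiag C n).
  by apply/matrixP => a b; rewrite !mxE; case: eqP; rewrite ?mpolyC0 ?mpolyC1.
have TX : map_mx T X = X *m map_mx (@mpolyC _ _) g.
  by apply/matrixP => a b; rewrite mxE; exact: translate_X.
have TJ : map_mx T (antidiag P n) = antidiag P n.
  by apply/matrixP => a b; rewrite !mxE; case: eqP; rewrite /T ?comp_mpoly0 ?comp_mpoly1.
transitivity (map_mx T (X *m antidiag _ n *m X^T) i j); first by rewrite [RHS]mxE.
have eg : map_mx (@mpolyC (k * n) C) g *m antidiag P n *m map_mx (@mpolyC _ _) g^T
    = antidiag P n by rewrite eJ -!map_mxM hg.
rewrite !map_mxM TJ -map_trmx TX trmx_mul map_trmx.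
by rewrite -[in RHS]eg !mulmxA.
Qed.

Lemma invariants_det l (A : 'M[P]_l) :
  (forall a b, invariants C n k (A a b)) -> invariants C n k (\det A).
Proof.
move=> h g hg; pose T := transT g.
transitivity (\det (map_mx T A)); first by rewrite det_map_mx.
by congr (\det _); apply/matrixP => a b; rewrite mxE; exact: h.
Qed.

Lemma invariantsZ c p : invariants C n k p -> invariants C n k (c *: p).
Proof. by move=> h g hg; rewrite /translate comp_mpolyZ -/(translate g p) h. Qed.

Lemma invariants_nat e : invariants C n k e%:R.
Proof. by move=> g hg; exact: (rmorph_nat (transT g)). Qed.

Lemma invariants_entry_M r c : (r < k)%N -> (c < k)%N -> invariants C n k (entry M r c).
Proof.
move=> hr hc.
have hr' : (r < k + n)%N by rewrite ltn_addr.
have hc' : (c < k + n)%N by rewrite ltn_addr.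
rewrite (entry_ord _ hr' hc') Mmx_blockE.
have -> : Ordinal hr' = lshift n (Ordinal hr) by apply: val_inj.
have -> : Ordinal hc' = lshift n (Ordinal hc) by apply: val_inj.
by rewrite block_mxEul; exact: invariants_gram.
Qed.

(** Reversing both the rows and the columns, and transposing, brings a minor
    in the columns [n - 1, ..., n - l] to the form [rminor]. *)
Lemma det_rev_rminor l (f : 'I_l -> 'I_k) : (l <= n)%N ->
  \det (\matrix_(a < l, b < l) entry X (f b) (n.-1 - a)) = rminor C n (fun a => f (rev_ord a)).
Proof.
move=> ln; rewrite -det_tr -(det_perm_mxsub (perm rev_ord_inj)); congr (\det _).
apply/matrixP => a b; rewrite !mxE !permE; congr (entry _ _ _) => /=.
by have := ltn_ord b; lia.
Qed.

(** The matrix has the shape [[r, Y], [Z, 0]], where [r] has invariant entries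
    and [Y], [Z^T] are made of the last [t] and [d] columns of the second set
    of variables.  Writing [(Z, 0) = Z *m (1, 0)] and [(Y^T, 0)] likewise, the
    expansions along the last [d] rows and the last [t] columns produce minors
    of [Z] and [Y], and leave determinants with entries among the [r_ij], 0
    and 1. *)
Lemma det_submx_Mt_expansion t d : (t <= d)%N -> (d <= k)%N -> (t + d <= n)%N ->
  (n < t + k)%N ->
  exists2 s : seq (P * (P * P)),
    forall x, x \in s -> [/\ invariants C n k x.1, x.2.1 \in rminors C n k d
                          & x.2.2 \in rminors C n k t]
    & \det (submx_at Mt n.+1 (d + k - n).-1 (t + k - n).-1)
      = \sum_(x <- s) tens x.1 (x.2.1 * x.2.2).
Proof.
move=> le_td le_dk le_tdn lt_ntk.
set al := (d + k - n).-1; set be := (t + k - n).-1.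
pose m := (n - d).+1; pose m' := (n - t).+1.
have eal : (al + m = k)%N by rewrite /al /m; lia.
have ebe : (be + m' = k)%N by rewrite /be /m'; lia.
have e1 : n.+1 = (m + d)%N by rewrite /m; lia.
have e2 : (m + d)%N = (m' + t)%N by rewrite /m /m'; lia.
pose r i c := entry M (al + i) (be + c).
have hf (a : 'I_m') : (be + a < k)%N by have := ltn_ord a; lia.
have hg (a : 'I_m) : (al + a < k)%N by have := ltn_ord a; lia.
pose U : 'M_(m, m + d) := \matrix_(i, c) entry Mt (al + i) (be + c).
pose Z : 'M_(d, m') := \matrix_(l, j) tensr (entry X (be + j) (n.-1 - l)).
pose W : 'M[{mpoly C[k * n + k * n]}]_(m', m + d) := \matrix_(j, c) (c == j :> nat)%:R.
pose Z' : 'M_(t, m) := \matrix_(l, i) tensr (entry X (al + i) (n.-1 - l)).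
pose W' : 'M[{mpoly C[k * n + k * n]}]_(m, m' + t) := \matrix_(i, c) (c == i :> nat)%:R.
pose q (f : {ffun 'I_d -> 'I_m'}) (i c : nat) : P :=
  if (i < m)%N then r i c else oapp (fun l : 'I_d => (c == f l)%:R) 0 (insub (i - m)%N).
pose Q (f : {ffun 'I_d -> 'I_m'}) (g : {ffun 'I_t -> 'I_m}) : 'M[P]_(m' + t) :=
  col_mx (\matrix_(c < m', i < m' + t) q f i c)
         (\matrix_(l < t, i < m' + t) (i == g l :> nat)%:R).
have stepZ : \det (submx_at Mt n.+1 al be) *+ d`!
    = \sum_(f : {ffun 'I_d -> 'I_m'}) \det (colsub f Z) * \det (col_mx U (rowsub f W)).
  rewrite -det_col_mx_mul_minors -(det_castmx e1); congr (\det _ *+ _).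
  apply/matrixP => i c; rewrite castmxE mxE /= -(splitK i); case: (split i) => {}i /=.
    by rewrite col_mxEu mxE.
  rewrite col_mxEd mxE; have li := ltn_ord i; have lc := ltn_ord c.
  have -> : (al + (m + i) = k + i)%N by rewrite addnA eal.
  have [hc|hc] := ltnP c m'.
    rewrite (bigD1 (Ordinal hc)) //= !mxE eqxx mulr1 big1 ?addr0.
      have hbc : (be + c < k)%N by lia.
      rewrite entry_Mt ltnNge leq_addr /= entry_M_dl //; lia.
    move=> j nj; rewrite !mxE; suff /negPf -> : (c != j :> nat) by rewrite mulr0.
    by apply: contra nj => /eqP e; apply/eqP/val_inj.
  rewrite big1; last first.
    by move=> j _; rewrite !mxE gtn_eqF ?mulr0 // (leq_trans (ltn_ord j)).
  have -> : (be + c = k + (c - m'))%N by lia.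
  rewrite entry_Mt ltnNge leq_addr /= entry_M_ur; last by lia.
  rewrite ltnNge leq_addr /=; case: ifP => _; last exact: rmorph0.
  by rewrite ltn_eqF ?rmorph0 //; lia.
have stepY (f : {ffun 'I_d -> 'I_m'}) : \det (col_mx U (rowsub f W)) *+ t`!
    = \sum_(g : {ffun 'I_t -> 'I_m}) \det (colsub g Z') * tensl (\det (Q f g)).
  rewrite -det_tr -(det_castmx e2).
  pose U' : 'M_(m', m' + t) := \matrix_(c, i) tensl (q f i c).
  transitivity (\det (col_mx U' (Z' *m W')) *+ t`!).
    congr (\det _ *+ _); apply/matrixP => c i; rewrite castmxE mxE.
    have li := ltn_ord i.
    have [hi|hi] := ltnP i m.
      have -> : cast_ord (esym e2) i = lshift d (Ordinal hi) by apply: val_inj.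
      rewrite col_mxEu mxE /= -(splitK c); case: (split c) => {}c /=.
        rewrite col_mxEu mxE /q hi entry_Mt.
        by rewrite (hg (Ordinal hi)) (hf c).
      rewrite col_mxEd mxE addnA ebe entry_Mt (ltnNge (k + c)) leq_addr andbF /=.
      have lc := ltn_ord c.
      rewrite entry_M_ur; last by lia.
      rewrite (hg (Ordinal hi)) (bigD1 (Ordinal hi)) //= !mxE eqxx mulr1 big1 ?addr0 //.
      move=> j nj; rewrite !mxE; suff /negPf -> : (i != j :> nat) by rewrite mulr0.
      by apply: contra nj => /eqP e; apply/eqP/val_inj.
    have hi2 : (i - m < d)%N by lia.
    have -> : cast_ord (esym e2) i = rshift m (Ordinal hi2) by apply: val_inj => /=; lia.
    rewrite col_mxEd [LHS]mxE [LHS]mxE /= -(splitK c); case: (split c) => {}c /=.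
      by rewrite col_mxEu mxE /q ltnNge hi /= (insubT (fun x => x < d)%N hi2) /= rmorph_nat.
    rewrite col_mxEd mxE gtn_eqF; last by rewrite ltn_addr.
    rewrite big1 // => j _; rewrite !mxE gtn_eqF ?mulr0 //.
    exact: leq_trans (ltn_ord j) hi.
  rewrite det_col_mx_mul_minors; apply: eq_bigr => g _; congr (_ * _).
  rewrite -det_map_mx; congr (\det _); rewrite map_col_mx; congr col_mx.
    by apply/matrixP => c i; rewrite !mxE.
  by apply/matrixP => c i; rewrite !mxE rmorph_nat.
have invQ f g : invariants C n k (\det (Q f g)).
  apply: invariants_det => c i; rewrite -(splitK c); case: (split c) => {}c /=.
    rewrite col_mxEu mxE /q; case: ifP => hi.
      by apply: invariants_entry_M; [exact: (hg (Ordinal hi)) | exact: hf].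
    by case: insub => [l|] /=; [exact: invariants_nat | exact: (invariants_nat 0)].
  by rewrite col_mxEd mxE; exact: invariants_nat.
pose zf (f : {ffun 'I_d -> 'I_m'}) := rminor C n (fun a => Ordinal (hf (f (rev_ord a)))).
pose yg (g : {ffun 'I_t -> 'I_m}) := rminor C n (fun a => Ordinal (hg (g (rev_ord a)))).
have zE (f : {ffun 'I_d -> 'I_m'}) : \det (colsub f Z) = tensr (zf f).
  rewrite /zf -(det_rev_rminor (fun a => Ordinal (hf (f a)))); last by lia.
  by rewrite -det_map_mx; congr (\det _); apply/matrixP => a b; rewrite !mxE.
have yE (g : {ffun 'I_t -> 'I_m}) : \det (colsub g Z') = tensr (yg g).
  rewrite /yg -(det_rev_rminor (fun a => Ordinal (hg (g a)))); last by lia.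
  by rewrite -det_map_mx; congr (\det _); apply/matrixP => a b; rewrite !mxE.
(* The two expansions produce the factors [d`!] and [t`!]. *)
pose c : C := ((d`! * t`!)%N%:R)^-1.
exists [seq (c *: \det (Q x.1 x.2), (zf x.1, yg x.2))
       | x <- enum {: {ffun 'I_d -> 'I_m'} * {ffun 'I_t -> 'I_m}}].
  move=> x /mapP[[f g] _ ->] /=; split; [|exact: mem_rminors..].
  exact/invariantsZ/invQ.
rewrite big_map big_enum /=.
have c0 : (d`! * t`!)%N%:R != 0 :> C.
  by rewrite pnatr_eq0 -lt0n muln_gt0 !fact_gt0.
apply: (scalerI c0); rewrite scaler_nat mulrnA stepZ -sumrMnl scaler_sumr.
rewrite -(pair_bigA _ (fun f g => (d`! * t`!)%N%:R *: tens (c *: \det (Q f g)) (zf f * yg g))) /=.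
apply: eq_bigr => f _; rewrite -mulrnAr stepY mulr_sumr; apply: eq_bigr => g _.
rewrite tensE [tensl (c *: _)]comp_mpolyZ -/(tensl _) -scalerAl scalerA divff // scale1r.
by rewrite zE yE rmorphM /= mulrA mulrC.
Qed.

End Bordered.

(** * The factor attached to a partition *)

Lemma partition_nth_le (s : seq nat) i j : is_partition s -> (i <= j)%N ->
  (nth 0%N s j <= nth 0%N s i)%N.
Proof.
move=> hs hij; have [hj|hj] := ltnP j (size s); last by rewrite nth_default.
apply: (sorted_leq_nth _ _ 0%N hs) => //.
- by move=> x y z /= h1 h2; exact: leq_trans h2 h1.
- by move=> x /=.
- by rewrite inE; exact: leq_ltn_trans hj.
Qed.

Lemma telescope_partition (s : seq nat) r m : is_partition s ->
  (\sum_(0 <= i < m) ((r <= i) * (nth 0 s i - nth 0 s i.+1))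
   = if r <= m then nth 0 s r - nth 0 s m else 0)%N.
Proof.
move=> hs; elim: m => [|m IH].
  by rewrite big_geq //; case: r => //=; rewrite subnn.
rewrite big_nat_recr //= IH.
have h1 := partition_nth_le hs (leqnSn m).
have [h|h] := leqP r m; rewrite ?mul1n ?mul0n ?addn0.
  by rewrite (leqW h); have := partition_nth_le hs h; lia.
have [h2|//] := leqP r m.+1; have -> : r = m.+1 by lia.
by rewrite subnn.
Qed.

Section DeltaPart.
Variables (C : numFieldType) (n k : nat).
Local Notation P := {mpoly C[k * n]}.

Definition column_lengths (nu : seq nat) : seq nat :=
  flatten [seq nseq (nth 0 nu j.-1 - nth 0 nu j)%N j | j <- index_iota 1 (minn n k).+1].

Lemma delta_part_prod nu : delta_part C n k nu = delta_prod C n k (column_lengths nu).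
Proof.
rewrite /delta_part /delta_prod /column_lengths.
elim: (index_iota _ _) => [|j s IH]; first by rewrite !big_nil.
by rewrite big_cons /= big_cat /= IH big_nseq iter_mulr_1.
Qed.

Lemma bounded_column_lengths nu : bounded n k (column_lengths nu).
Proof.
apply/allP => l /flattenP[s /mapP[j hj ->]].
by rewrite mem_nseq => /andP[_ /eqP ->]; move: hj; rewrite mem_index_iota ltnS => /andP[].
Qed.

Lemma dx_delta_part_eq0 nu t i (c : 'I_n) : size nu = t -> (c < n - t)%N ->
  dx i c (delta_part C n k nu) = 0.
Proof.
move=> snu hc; rewrite /delta_part /dx big_seq.
apply: (big_ind (fun p : P => mderiv (mxvec_index i c) p = 0)).
- by rewrite -mpolyC1 mderivC.
- by move=> p q hp hq; rewrite mderivM hp hq mul0r mulr0 addr0.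
move=> j; rewrite mem_index_iota => /andP[j1 jm].
have [hj|hj] := leqP j t; last first.
  by rewrite [nth 0%N nu j.-1]nth_default ?sub0n ?expr0 -?mpolyC1 ?mderivC //; lia.
have d0 : mderiv (mxvec_index i c) (delta_minor C n k j) = 0.
  have h (a : 'I_j) : (k - j + a < k)%N by have := ltn_ord a; lia.
  by apply: (@dx_rminor_eq0 C n k i c j (fun a => Ordinal (h a))); lia.
elim: (_ - _)%N => [|e IH]; first by rewrite expr0 -mpolyC1 mderivC.
by rewrite exprS mderivM d0 IH mul0r mulr0 addr0.
Qed.

Lemma prod_delta_minor_eq t : (t <= minn n k)%N ->
  \prod_(1 <= j < (minn n k).+1) delta_minor C n k j ^+ (j == t) = delta_minor C n k t.
Proof.
move=> ht; case: t ht => [|t] ht.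
  rewrite [RHS]det_mx00 big_seq big1 // => j; rewrite mem_index_iota.
  by case: j => [|j] //= _; rewrite expr0.
rewrite (bigD1_seq t.+1) ?iota_uniq ?mem_index_iota //= eqxx expr1.
by rewrite big1 ?mulr1 // => j /negPf ->; rewrite expr0.
Qed.

Lemma delta_part_add_columns nu mu t d : (t <= minn n k)%N -> (d <= minn n k)%N ->
  is_partition mu ->
  (forall j, nth 0%N nu j = ((j < d) + (j < t) + nth 0 mu j)%N) ->
  delta_part C n k nu = delta_minor C n k d * (delta_minor C n k t * delta_part C n k mu).
Proof.
move=> ht hd hmu enu; rewrite -(prod_delta_minor_eq ht) -(prod_delta_minor_eq hd).
rewrite /delta_part -!big_split /=; apply: eq_big_seq => j.
rewrite mem_index_iota => /andP[j1 _]; rewrite -!exprD; congr (_ ^+ _).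
have := partition_nth_le hmu (leq_pred j); rewrite !enu.
have -> : (j.-1 < d)%N = (j <= d)%N by lia.
have -> : (j.-1 < t)%N = (j <= t)%N by lia.
by case: (ltngtP j d); case: (ltngtP j t) => /=; lia.
Qed.

Lemma evalmx_delta_part_bottom_id nu : evalmx (bottom_id C n k) (delta_part C n k nu) = 1.
Proof. by rewrite delta_part_prod; exact/delta_prod_bottom_id/bounded_column_lengths. Qed.

(** ** Weights *)

Lemma sum_diag_window (s N lo hi : nat) : (lo < s + N)%N ->
  (\sum_(i < N) ((s + i == lo) && (s + i == hi)) = (lo == hi) && (s <= lo))%N.
Proof.
move=> h; case: (eqVneq lo hi) => [<-|ne] /=; last first.
  rewrite big1 // => i _; apply/eqP; rewrite eqb0; apply/negP => /andP[/eqP e /eqP e'].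
  by rewrite -e -e' eqxx in ne.
have [hs|hs] := leqP s lo; last first.
  by rewrite big1 // => i _; rewrite gtn_eqF // ltn_addr.
have hi' : (lo - s < N)%N by lia.
rewrite (bigD1 (Ordinal hi')) //= subnKC // eqxx big1 // => i ni.
rewrite andbb; apply/eqP; rewrite eqb0; apply: contra ni => /eqP e.
by apply/eqP/val_inj => /=; lia.
Qed.

(** [D] puts row [hi] in the place of row [lo], and likewise for columns when [b]
    holds; on the window this is a multiplication by an elementary matrix, whose
    trace is zero unless [lo = hi].  The symmetric bordered matrix needs
    [b = true], the minors of the [x_il] need [b = false]. *)
Lemma eigen_window (R : comNzRingType) (D : R -> R) N s s' lo hi
    (F : nat -> nat -> R) (b : bool) :
  derivation D -> (lo <= hi)%N -> (hi < s + N)%N -> (b -> hi < s' + N)%N ->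
  (forall i j, D (F i j) = (i == lo)%:R * F hi j + (b && (j == lo))%:R * F i hi) ->
  eigen D (((lo == hi) && (s <= lo)) + b * ((lo == hi) && (s' <= lo)))%N
    (\det (\matrix_(i < N, j < N) F (s + i)%N (s' + j)%N)).
Proof.
move=> dD le_lh hs hs' DF.
pose E (w : nat) : 'M[R]_N := \matrix_(i, i') ((w + i == lo) && (w + i' == hi))%N%:R.
have trE w : (lo < w + N)%N -> \tr (E w) = ((lo == hi) && (w <= lo))%N%:R.
  move=> hw; rewrite -(sum_diag_window _ hw) natr_sum; apply: eq_bigr => i _.
  by rewrite mxE.
have pick w (i : 'I_N) (G : nat -> R) : (hi < w + N)%N ->
    \sum_(i' < N) ((w + i == lo) && (w + i' == hi))%N%:R * G (w + i')%N
    = (w + i == lo)%N%:R * G hi.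
  move=> hw; case: eqP => [e|_] /=; last by rewrite mul0r big1 // => *; rewrite mul0r.
  have h : (hi - w < N)%N by have := ltn_ord i; lia.
  rewrite (bigD1 (Ordinal h)) //= subnKC; last by lia.
  rewrite eqxx big1 ?addr0 // => i' ni; suff /negPf -> : (w + i' != hi)%N by rewrite mul0r.
  by apply: contra ni => /eqP e'; apply/eqP/val_inj => /=; lia.
rewrite /eigen (derivation_det_eigen dD (N := E s) (N' := b%:R *: (E s')^T)).
  rewrite mxtraceZ mxtrace_tr trE; last by lia.
  rewrite -[in RHS]mulr_natl natrD natrM; congr ((_ + _) * _).
  by case: (b) hs' => [/(_ isT) h|_]; rewrite ?mul0r // trE //; lia.
apply/matrixP => i j; rewrite 4!mxE DF; congr (_ + _).
  rewrite -(pick s i (fun r => F r (s' + j)%N)) //.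
  by apply: eq_bigr => i' _; rewrite !mxE.
rewrite [RHS]mxE; case: b hs' DF => [/(_ isT) h|_] DF; last first.
  by rewrite mul0r big1 // => i' _; rewrite !mxE mul0r mulr0.
rewrite andTb -(pick s' j (fun r => F (s + i)%N r)) //.
by apply: eq_bigr => i' _; rewrite !mxE mul1r mulrC.
Qed.

Lemma eigen_polarization_delta_minor (lo hi : 'I_k) l : (lo <= hi)%N -> (l <= k)%N ->
  eigen (@polarization C n k hi lo) ((lo == hi) && (k - l <= lo))%N (delta_minor C n k l).
Proof.
move=> le_lh lk.
have := @eigen_window _ _ l (k - l) (n - l) lo hi (entry (xmx C n k)) false
  (polarization_derivation C n hi lo) le_lh.
rewrite mul0n addn0 (inj_eq val_inj); apply => //; first by rewrite subnK.
by move=> i j; rewrite polarization_entry; case: eqP; rewrite !mul0r addr0 ?mul1r.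
Qed.

Lemma eigen_polarization_delta_part (lo hi : 'I_k) nu : (lo <= hi)%N ->
  is_partition nu -> (size nu <= minn n k)%N ->
  eigen (@polarization C n k hi lo) ((lo == hi) * nth 0 nu (rev_ord lo))%N
    (delta_part C n k nu).
Proof.
move=> le_lh hnu snu; have dP := polarization_derivation C n hi lo.
have -> : ((lo == hi) * nth 0 nu (rev_ord lo) =
  \sum_(1 <= j < (minn n k).+1)
    ((lo == hi) && (k - j <= lo)) * (nth 0 nu j.-1 - nth 0 nu j))%N.
  have := telescope_partition (rev_ord lo) (minn n k) hnu.
  rewrite (nth_default _ snu) subn0 big_add1 /= => e.
  transitivity ((lo == hi) * (if (rev_ord lo <= minn n k) then nth 0 nu (rev_ord lo) else 0))%N.
    congr (_ * _)%N; case: leqP => // h; rewrite nth_default //; exact: leq_trans snu (ltnW h).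
  rewrite -e big_distrr /=; apply: eq_big_nat => j /andP[_ hj].
  have lk := ltn_ord lo; rewrite mulnA mulnb; congr (nat_of_bool _ * _)%N.
  by congr (_ && _); move: hj; rewrite leq_min; lia.
rewrite /delta_part big_seq [X in eigen _ _ X]big_seq; apply: eigen_prod => // j.
rewrite mem_index_iota ltnS leq_min => /and3P[_ _ jk].
by apply: eigenX => //; exact: eigen_polarization_delta_minor.
Qed.

End DeltaPart.

Section HighestWeight.
Variables (C : numFieldType) (n k : nat).
Local Notation P := {mpoly C[k * n]}.
Local Notation X := (xmx C n k).
Local Notation M := (Mmx C n k).
Local Notation Mt := (Mmx_tens C n k).

(** Removing the scalar part of the action of [h_ij] leaves a derivation. *)
Definition tens_polarization (i j : 'I_k) (v : {mpoly C[k * n + k * n]}) :=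
  tens_hop i j v - (n%:R / 2 * (i == j)%:R) *: v.

Lemma tens_polarization_derivation i j : derivation (tens_polarization i j).
Proof.
have E v : tens_polarization i j v
    = \sum_(l < n) 'X_(lshift (k * n) (mxvec_index i l))
               * mderiv (lshift (k * n) (mxvec_index j l)) v
      + \sum_(l < n) 'X_(rshift (k * n) (mxvec_index i l))
                 * mderiv (rshift (k * n) (mxvec_index j l)) v.
  by rewrite /tens_polarization /tens_hop addrK.
have pull (p q : {mpoly C[k * n + k * n]}) u w :
    'X_w * mderiv u (p * q) = ('X_w * mderiv u p) * q + p * ('X_w * mderiv u q).
  by rewrite mderivM mulrDr; congr (_ + _); [exact: mulrA | exact: mulrCA].
split=> p q; rewrite !E.
  rewrite addrACA; congr (_ + _); rewrite -big_split;
    by apply: eq_bigr => l _; rewrite /= mderivD mulrDr.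
rewrite mulrDl mulrDr addrACA !mulr_suml !mulr_sumr.
by congr (_ + _); rewrite -big_split; apply: eq_bigr => l _; rewrite pull.
Qed.

Lemma tens_polarization_tens i j p q :
  tens_polarization i j (tens p q) = tens (polarization i j p) q + tens p (polarization i j q).
Proof.
rewrite /tens_polarization tens_hop_tens /hop -addrA; congr (_ + _).
by rewrite !tensE rmorphD /= [tensr (_ *: _)]comp_mpolyZ -/(tensr q) mulrDr -scalerAr addrK.
Qed.

Lemma polarization1 i j : polarization i j (1 : P) = 0.
Proof. exact: (derivation1 (polarization_derivation C n i j)). Qed.

Lemma tens_polarization_tensl i j p :
  tens_polarization i j (tensl p) = tensl (polarization i j p).
Proof.
by rewrite -tens1r tens_polarization_tens polarization1 !tensE rmorph0 rmorph1 mulr1 mulr0 addr0.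
Qed.

Lemma tens_polarization_tensr i j p :
  tens_polarization i j (tensr p) = tensr (polarization i j p).
Proof.
by rewrite -tens1l tens_polarization_tens polarization1 !tensE rmorph0 rmorph1 mul1r mul0r add0r.
Qed.

Lemma entry_M_sym r c : entry M r c = entry M c r.
Proof.
have aT : (antidiag P n)^T = antidiag P n.
  apply/matrixP => a b; rewrite !mxE; congr (nat_of_bool _)%:R.
  by rewrite -(inj_eq rev_ord_inj) rev_ordK eq_sym.
have MT : M^T = M.
  by rewrite /Mmx !trmx_mul tr_col_mx tr_row_mx trmxK trmx1 aT mulmxA.
have [hr|hr] := ltnP r (k + n); last by rewrite entry_ge_row // entry_ge_col.
have [hc|hc] := ltnP c (k + n); last by rewrite entry_ge_col // entry_ge_row.
by rewrite !(entry_ord _ hr hc) !(entry_ord _ hc hr) -{1}MT mxE.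
Qed.

Lemma polarization_entry_M (hi lo : 'I_k) r c :
  polarization hi lo (entry M r c)
  = (r == lo)%:R * entry M hi c + (c == lo)%:R * entry M r hi.
Proof.
have [PD PM] := polarization_derivation C n hi lo.
have P0 : polarization hi lo (0 : P) = 0 by apply: derivation0.
have klo x : (k + x == lo)%N = false by rewrite gtn_eqF // ltn_addr.
have up x l : (l < n)%N -> (x < k)%N -> polarization hi lo (entry M x (k + l))
    = (x == lo)%:R * entry M hi (k + l) + (k + l == lo)%N%:R * entry M x hi.
  move=> hl hx; rewrite klo mul0r addr0 !entry_M_ur // hx ltn_ord polarization_entry.
  by case: eqP; rewrite ?mul1r ?mul0r.
have [hr|hr] := ltnP r (k + n); last first.
  rewrite !(entry_ge_row _ _ hr) mulr0 addr0 P0 gtn_eqF ?mul0r //.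
  by apply: leq_trans hr; rewrite ltn_addr.
have [hc|hc] := ltnP c (k + n); last first.
  rewrite !(entry_ge_col _ _ hc) mulr0 add0r P0 gtn_eqF ?mul0r //.
  by apply: leq_trans hc; rewrite ltn_addr.
have [hrk|hrk] := ltnP r k; have [hck|hck] := ltnP c k.
- have gramE x y (hx : (x < k)%N) (hy : (y < k)%N) : entry M x y
      = \sum_(l < n) entry X x l * entry X y (rev_ord l).
    have hx' : (x < k + n)%N by rewrite ltn_addr.
    have hy' : (y < k + n)%N by rewrite ltn_addr.
    rewrite (entry_ord _ hx' hy').
    have -> : Ordinal hx' = lshift n (Ordinal hx) by apply: val_inj.
    have -> : Ordinal hy' = lshift n (Ordinal hy) by apply: val_inj.
    rewrite Mmx_ul; apply: eq_bigr => l _.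
    rewrite (entry_ord _ hx (ltn_ord l)) (entry_ord _ hy (ltn_ord (rev_ord l))).
    by congr (X _ _ * X _ _); apply: val_inj.
  rewrite !gramE // derivation_sum; last exact: polarization_derivation.
  rewrite !mulr_sumr -big_split; apply: eq_bigr => l _ /=.
  rewrite PM !polarization_entry; congr (_ + _).
    by case: eqP; rewrite ?mul1r ?mul0r.
  by case: eqP; rewrite ?mul1r ?mul0r ?mulr0.
- by rewrite -(subnKC hck); apply: up => //; lia.
- rewrite entry_M_sym addrC (entry_M_sym hi) (entry_M_sym r).
  by rewrite -(subnKC hrk); apply: up => //; lia.
rewrite -(subnKC hrk) -(subnKC hck) !klo !mul0r addr0.
rewrite entry_M_ur; last by lia.
rewrite ltnNge leq_addr /=; case: ifP => // _.
by case: eqP => _; rewrite ?P0 // polarization1.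
Qed.

Lemma tens_polarization_entry_Mt (hi lo : 'I_k) r c :
  tens_polarization hi lo (entry Mt r c)
  = (r == lo)%:R * entry Mt hi c + (c == lo)%:R * entry Mt r hi.
Proof.
have mor (f : {rmorphism P -> {mpoly C[k * n + k * n]}}) (a b : bool) p q :
    f (a%:R * p + b%:R * q) = a%:R * f p + b%:R * f q.
  by rewrite rmorphD !rmorphM !rmorph_nat.
have ne x : (k <= x)%N -> (x == lo) = false.
  by move=> hx; rewrite gtn_eqF // (leq_trans (ltn_ord lo)).
rewrite !entry_Mt (ltn_ord hi) /= andbT.
have [hr|/ne hr] := ltnP r k; have [hc|/ne hc] := ltnP c k => /=.
- by rewrite tens_polarization_tensl polarization_entry_M mor.
- by rewrite tens_polarization_tensr polarization_entry_M mor hc !mul0r.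
- by rewrite tens_polarization_tensr polarization_entry_M mor hr !mul0r.
by rewrite tens_polarization_tensr polarization_entry_M mor hr hc !mul0r.
Qed.

Lemma eigen_tens_polarization_det_vector (lo hi : 'I_k) t d mu :
  (lo <= hi)%N -> (t <= d)%N -> (d <= k)%N -> (t + d <= n)%N -> (n < t + k)%N ->
  is_partition mu -> size mu = t ->
  eigen (tens_polarization hi lo)
    ((lo == hi) * ((d + k - n <= lo.+1) + (t + k - n <= lo.+1) + nth 0 mu (rev_ord lo)))%N
    (det_vector C n k (d + k - n) (t + k - n) mu).
Proof.
move=> le_lh le_td le_dk le_tdn lt_ntk hmu smu.
have dD := tens_polarization_derivation hi lo.
have lhi := ltn_ord hi.
have hA := @eigen_window _ _ n.+1 (d + k - n).-1 (t + k - n).-1 lo hi (entry Mt) true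
  dD le_lh ltac:(lia) ltac:(lia) (fun i j => tens_polarization_entry_Mt hi lo i j).
have hB : eigen (tens_polarization hi lo) ((lo == hi) * nth 0 mu (rev_ord lo))%N
    (tens 1 (delta_part C n k mu)).
  rewrite /eigen tens1l tens_polarization_tensr eigen_polarization_delta_part //.
    by rewrite rmorphMn.
  by rewrite smu leq_min; lia.
have := eigenM dD hA hB; rewrite /det_vector; congr eigen.
rewrite (inj_eq val_inj) mul1n !mulnDr !mulnb; congr (_ + _ + _)%N.
  by congr (nat_of_bool (_ && _)); lia.
by congr (nat_of_bool (_ && _)); lia.
Qed.

End HighestWeight.

(** * Non-vanishing *)

Section NonVanishing.
Variables (C : numFieldType) (n k : nat).
Local Notation P := {mpoly C[k * n]}.
Local Notation X := (xmx C n k).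
Local Notation M := (Mmx C n k).
Local Notation Mt := (Mmx_tens C n k).
Local Notation bottom_id := (bottom_id C n k).

(** The vectors e_p + e_(n-1-p), e_p - e_(n-1-p) and the middle e_p form an
    orthogonal basis of anisotropic vectors for the antidiagonal form. *)
Definition osign (p : nat) : C :=
  if (p.*2 < n.-1)%N then 1 else if p.*2 == n.-1 then 0 else -1.

Definition obasis (p l : nat) : C := (l == p)%:R + osign p * (l + p == n.-1)%N%:R.

Lemma obasis_form p q : (p < n)%N -> (q < n)%N ->
  \sum_(l < n) obasis p l * obasis q (n.-1 - l)
  = (p == q)%:R * (if p.*2 == n.-1 then 1 else 2 * osign p).
Proof.
move=> hp hq.
have hp' : (n.-1 - p < n)%N by lia.
have pick (r : nat) (hr : (r < n)%N) (F : nat -> C) :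
    \sum_(l < n) (l == r :> nat)%:R * F l = F r.
  rewrite (bigD1 (Ordinal hr)) //= eqxx mul1r big1 ?addr0 // => l nl.
  suff /negPf -> : (l != r :> nat) by rewrite mul0r.
  by apply: contra nl => /eqP e; apply/eqP/val_inj.
have -> : \sum_(l < n) obasis p l * obasis q (n.-1 - l)
    = obasis q (n.-1 - p) + osign p * obasis q p.
  rewrite -(pick p hp (fun l => obasis q (n.-1 - l))).
  have e : obasis q p = obasis q (n.-1 - (n.-1 - p)) by rewrite subKn //; lia.
  rewrite e -(pick _ hp' (fun l => obasis q (n.-1 - l))).
  rewrite mulr_sumr -big_split; apply: eq_bigr => l _ /=.
  rewrite /obasis mulrDl -mulrA; congr (_ + _ * (_%:R * _)).
  by congr nat_of_bool; have := ltn_ord l; lia.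
rewrite /obasis.
have -> : (n.-1 - p == q)%N = (p + q == n.-1)%N by lia.
have -> : (n.-1 - p + q == n.-1)%N = (p == q) by lia.
have [<-|npq] := eqVneq p q.
  rewrite addnn /osign; case: (ltngtP p.*2 n.-1) => _; rewrite /= ?mulr0n ?mulr1n; ring.
rewrite mul0r; have [e|_] := eqVneq (p + q)%N n.-1; last by rewrite /= !mulr0n; ring.
suff opq : osign p * osign q = -1.
  by rewrite /= !mulr0n !mulr1n mulr0 addr0 add0r mulr1 opq subrr.
have [lt|lt] : (p.*2 < n.-1 < q.*2 \/ q.*2 < n.-1 < p.*2)%N.
- by move/eqP: npq; lia.
- case/andP: lt => h1 h2; rewrite /osign h1 ltnNge (ltnW h2) /= gtn_eqF //; ring.
case/andP: lt => h1 h2; rewrite /osign h1 ltnNge (ltnW h2) /= gtn_eqF //; ring.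
Qed.

(** Rows repeating with period [s] have a Gram matrix whose window of order
    [s] is monomial, wherever the window is, and whose rank is only [s]. *)
Definition gram_point (s : nat) : 'M[C]_(k, n) := \matrix_(i, l) obasis (i %% s) l.

Lemma evalmx_gram_point s r c : (0 < s)%N -> (s <= n)%N -> (r < k)%N -> (c < k)%N ->
  evalmx (gram_point s) (entry M r c)
  = (r == c %[mod s])%:R * (if (r %% s).*2 == n.-1 then 1 else 2 * osign (r %% s)).
Proof.
move=> s0 sn hr hc.
have hr' : (r < k + n)%N by rewrite ltn_addr.
have hc' : (c < k + n)%N by rewrite ltn_addr.
rewrite (entry_ord _ hr' hc').
have -> : Ordinal hr' = lshift n (Ordinal hr) by apply: val_inj.
have -> : Ordinal hc' = lshift n (Ordinal hc) by apply: val_inj.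
rewrite Mmx_ul -obasis_form; [|exact: leq_trans (ltn_pmod _ s0) sn..].
rewrite /evalmx raddf_sum; apply: eq_bigr => l _ /=.
rewrite mevalM !mxE !mevalXU !mxvecE !mxE /=; congr (_ * obasis _ _).
by have := ltn_ord l; lia.
Qed.

Lemma obasis_norm_neq0 p : (if p.*2 == n.-1 then 1 else 2 * osign p) != 0 :> C.
Proof.
rewrite /osign; case: ltngtP => _; rewrite ?oner_neq0 // ?mulr1 ?mulrN1 ?oppr_eq0;
  by rewrite pnatr_eq0.
Qed.

(** The columns through [Y] and the rows through [Z] are unit vectors.  Eliminating
    them leaves a window of order [s], whose entries are nonzero exactly when the
    two indices agree modulo [s]. *)
Lemma det_bordered_neq0 t d m m' s al be (D : nat -> C) (A : 'M[C]_n.+1) :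
  (0 < s)%N -> (t <= d)%N -> (m + d = n.+1)%N -> (m' + t = n.+1)%N ->
  (s + (t + d) = n.+1)%N -> (al + m = k)%N -> (be + m' = k)%N ->
  (forall p, D p != 0) ->
  (forall i j : 'I_n.+1, (i < m)%N -> (j < m')%N ->
     A i j = (al + i == be + j %[mod s])%:R * D ((al + i) %% s)%N) ->
  (forall i j : 'I_n.+1, (i < m)%N -> (m' <= j)%N ->
     A i j = (k - (al + i) == (j - m').+1)%N%:R) ->
  (forall i j : 'I_n.+1, (m <= i)%N -> (j < m')%N ->
     A i j = (k - (be + j) == (i - m).+1)%N%:R) ->
  (forall i j : 'I_n.+1, (m <= i)%N -> (m' <= j)%N -> A i j = 0) ->
  \det A != 0.
Proof.
move=> s0 le_td em em' es eal ebe D0 Aul Aur Adl Adr.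
apply/negP => /det0P[v nz vA].
have col (j : 'I_n.+1) : \sum_i v 0 i * A i j = 0.
  by have := congr1 (fun u : 'rV_n.+1 => u 0 j) vA; rewrite !mxE.
(* The columns of Y are unit vectors, which isolate the last t of the m rows. *)
have v1 (i : 'I_n.+1) : (s <= i)%N -> (i < m)%N -> v 0 i = 0.
  move=> si im.
  have pos (i' : nat) : (i' < m)%N -> (k - (al + i')).-1.+1 = (k - (al + i'))%N.
    by move=> h; rewrite prednK // -eal subnDl subn_gt0.
  have hj : (m' + (k - (al + i)).-1 < n.+1)%N by clear -si im eal es em em'; lia.
  have := col (Ordinal hj); rewrite (bigD1 i) //= Aur //= ?leq_addr // addKn pos //.
  rewrite eqxx mulr1 big1 ?addr0 // => i' ni.
  have [hi'|hi'] := ltnP i' m; last by rewrite Adr ?mulr0 //= leq_addr.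
  rewrite Aur //= ?leq_addr // addKn pos //.
  suff /negPf -> : (k - (al + i') != k - (al + i))%N by rewrite mulr0.
  apply: contra ni => /eqP e; apply/eqP/val_inj => /=.
  by clear -e hi' im eal; lia.
(* The first s columns meet none of the last d rows: the Gram window remains. *)
have v2 (i : 'I_n.+1) : (i < m)%N -> v 0 i = 0.
  move=> im; have [si|si] := leqP s i; first exact: v1.
  pose r := ((i + (d - t)) %% s)%N.
  have js : (r < s)%N by rewrite ltn_mod.
  have econg : be + r = al + i %[mod s].
    rewrite modnDmr; congr (_ %% _)%N.
    by clear -le_td em em' eal ebe; lia.
  move: r js econg => r js econg.
  have hj : (r < n.+1)%N by clear -js es; lia.
  have jm : (r < m')%N by clear -js es em'; lia.
  have := col (Ordinal hj); rewrite (bigD1 i) //= Aul //=.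
  rewrite econg eqxx mul1r big1 ?addr0.
    by move/eqP; rewrite mulf_eq0 (negPf (D0 _)) orbF => /eqP.
  move=> i' ni; have [hi'|hi'] := ltnP i' m; last first.
    have li := ltn_ord i'; rewrite Adl //= gtn_eqF ?mulr0 //.
    by clear -li js hi' em em' es ebe; lia.
  have [si'|si'] := leqP s i'; first by rewrite v1 // mul0r.
  rewrite Aul //= econg.
  have -> : (al + i' == al + i %[mod s]) = (i' == i :> nat).
    by rewrite eqn_modDl !modn_small.
  suff /negPf -> : (i' != i :> nat) by rewrite mul0r mulr0.
  by apply: contra ni => /eqP e; apply/eqP/val_inj.
(* The rows of Z contain unit vectors, which isolate the last d coordinates. *)
case/eqP: nz; apply/rowP => i; rewrite [RHS]mxE.
have [im|im] := ltnP i m; first exact: v2.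
have li := ltn_ord i.
have hj : (m'.-1 - (i - m) < n.+1)%N by clear -em'; lia.
have jm : (m'.-1 - (i - m) < m')%N by clear -em' es s0; lia.
have ej : (k - (be + (m'.-1 - (i - m))) = (i - m).+1)%N.
  by clear -li im em em' es ebe s0; lia.
have := col (Ordinal hj); rewrite (bigD1 i) //= Adl //= ej eqxx mulr1 big1 ?addr0 // => i' ni.
have [im'|im'] := ltnP i' m; first by rewrite v2 // mul0r.
rewrite Adl //= ej; suff /negPf -> : ((i - m).+1 != (i' - m).+1)%N by rewrite mulr0.
apply: contra ni => /eqP e; apply/eqP/val_inj => /=.
by clear -e im im'; lia.
Qed.

Definition eval_point (G : 'M[C]_(k, n)) (u : 'I_(k * n + k * n)) : C :=
  match split u with inl u => mxvec G 0 u | inr u => mxvec bottom_id 0 u end.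

Lemma eval_point_tensl G p : (tensl p).@[eval_point G] = evalmx G p.
Proof.
rewrite /tensl comp_mpoly_meval; apply: meval_eq => u.
by rewrite tnth_mktuple mevalXU /eval_point -/(unsplit (inl u)) unsplitK.
Qed.

Lemma eval_point_tensr G p : (tensr p).@[eval_point G] = evalmx bottom_id p.
Proof.
rewrite /tensr comp_mpoly_meval; apply: meval_eq => u.
by rewrite tnth_mktuple mevalXU /eval_point -/(unsplit (inr u)) unsplitK.
Qed.

Lemma evalmx_bottom_id_entry_M_ur r l : (r < k)%N -> (l < n)%N ->
  evalmx bottom_id (entry M r (k + l)) = (k - r == l.+1)%N%:R.
Proof.
move=> hr hl; rewrite entry_M_ur // hr evalmx_entry entry_bottom_id //; last by lia.
by have -> : (n - (n.-1 - l) = l.+1)%N by lia.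
Qed.

(** Evaluate the second set of variables at [bottom_id] and the first one at a point of
    period [s = n + 1 - d - t]: the blocks [Y] and [Z] contain identity matrices
    which isolate a window of order [s] of the Gram matrix.  As the Gram matrix
    has rank at most [n], this window needs [s <= n], that is, [0 < d]. *)
Lemma det_vector_neq0 t d mu : (0 < d)%N -> (t <= d)%N -> (d <= k)%N ->
  (t + d <= n)%N -> (n < t + k)%N ->
  det_vector C n k (d + k - n) (t + k - n) mu != 0.
Proof.
move=> d0 le_td le_dk le_tdn lt_ntk.
pose s := (n.+1 - (t + d))%N; pose m := (n.+1 - d)%N; pose m' := (n.+1 - t)%N.
pose al := (d + k - n).-1; pose be := (t + k - n).-1.
have s0 : (0 < s)%N by clear -le_tdn; lia.
have sn : (s <= n)%N by clear -d0 le_tdn; lia.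
have em : (m + d = n.+1)%N by clear -le_tdn; lia.
have em' : (m' + t = n.+1)%N by clear -le_tdn; lia.
have es : (s + (t + d) = n.+1)%N by clear -le_tdn; lia.
have eal : (al + m = k)%N by clear -le_tdn le_td lt_ntk; lia.
have ebe : (be + m' = k)%N by clear -le_tdn le_td lt_ntk; lia.
apply/eqP => /(congr1 (meval (eval_point (gram_point s)))).
rewrite /det_vector -/al -/be mevalM tens1l eval_point_tensr.
rewrite evalmx_delta_part_bottom_id mulr1 meval0.
move: s m m' al be s0 sn em em' es eal ebe => s m m' al be s0 sn em em' es eal ebe.
rewrite -det_map_mx => /eqP; apply/negP.
pose D p : C := if p.*2 == n.-1 then 1 else 2 * osign p.
apply: (@det_bordered_neq0 t d m m' s al be D) => //.
- exact: obasis_norm_neq0.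
- move=> i j hi hj; have hi' : (al + i < k)%N by rewrite -eal ltn_add2l.
  have hj' : (be + j < k)%N by rewrite -ebe ltn_add2l.
  by rewrite 2!mxE entry_Mt hi' hj' /= eval_point_tensl evalmx_gram_point.
- move=> i j hi hj; have hi' : (al + i < k)%N by rewrite -eal ltn_add2l.
  rewrite 2!mxE; have -> : (be + j = k + (j - m'))%N by clear -hj ebe; lia.
  rewrite entry_Mt hi' ltnNge leq_addr /= eval_point_tensr evalmx_bottom_id_entry_M_ur //.
  by have lj := ltn_ord j; clear -lj em' hj le_tdn; lia.
- move=> i j hi hj; have hj' : (be + j < k)%N by rewrite -ebe ltn_add2l.
  rewrite 2!mxE; have -> : (al + i = k + (i - m))%N by clear -hi eal; lia.
  rewrite entry_Mt ltnNge leq_addr /= eval_point_tensr entry_M_sym.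
  rewrite evalmx_bottom_id_entry_M_ur //.
  by have li := ltn_ord i; clear -li em hi d0 le_tdn; lia.
move=> i j hi hj; have li := ltn_ord i; have lj := ltn_ord j.
rewrite 2!mxE; have -> : (al + i = k + (i - m))%N by clear -hi eal; lia.
have -> : (be + j = k + (j - m'))%N by clear -hj ebe; lia.
rewrite entry_Mt ltnNge leq_addr /= eval_point_tensr.
rewrite entry_M_ur; last by clear -lj em' hj le_tdn d0; lia.
rewrite ltnNge leq_addr /=; case: ifP => _; last exact: meval0.
rewrite ltn_eqF; first exact: meval0.
by clear -li lj hi hj em em' le_tdn d0; lia.
Qed.

End NonVanishing.

(** * Roots and the set Gamma *)

Section Roots.
Variable k : nat.
Implicit Types (a b v : 'rV[rat]_k) (i j p : 'I_k).

Lemma epsE i j : eps i 0 j = (i == j)%:R :> rat.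
Proof. by rewrite /eps mxE eqxx eq_sym. Qed.

Lemma wdotC a b : wdot a b = wdot b a.
Proof. by apply: eq_bigr => i _; rewrite mulrC. Qed.

Lemma wdotDl a b v : wdot (a + b) v = wdot a v + wdot b v.
Proof. by rewrite -big_split; apply: eq_bigr => i _; rewrite mxE mulrDl. Qed.

Lemma wdotZl c a v : wdot (c *: a) v = c * wdot a v.
Proof. by rewrite mulr_sumr; apply: eq_bigr => i _; rewrite mxE mulrA. Qed.

Lemma wdot_eps i v : wdot (eps i) v = v 0 i.
Proof.
rewrite /wdot (bigD1 i) //= epsE eqxx mul1r big1 ?addr0 // => j nj.
by rewrite epsE eq_sym (negPf nj) mul0r.
Qed.

Lemma scale_epsE x i p : (x *: eps p) 0 i = x * (i == p)%:R :> rat.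
Proof. by rewrite [LHS]mxE epsE eq_sym. Qed.

Lemma wdot_coroot v i j :
  wdot v (coroot (eps i + eps j)) = if i == j then v 0 i else v 0 i + v 0 j.
Proof.
rewrite wdotC /coroot wdotZl !wdotDl !wdot_eps !mxE !eqxx /= [j == i]eq_sym.
by case: eqP => [->|_]; rewrite ?mulr1n ?mulr0n; field.
Qed.

Lemma reflectionE v i j x : reflection (eps i + eps j) v 0 x
  = if x == i then - v 0 j else if x == j then - v 0 i else v 0 x.
Proof.
rewrite /reflection wdot_coroot mxE 3!mxE !epsE.
have [->|ni] := eqVneq x i.
  by have [->|nj] := eqVneq i j; rewrite ?mulr1n ?mulr0n; ring.
have [exj|nj] := eqVneq x j; last by rewrite ?mulr0n; ring.
by rewrite -exj eq_sym (negPf ni) ?mulr1n ?mulr0n exj; ring.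
Qed.

Lemma short_not_long a : short_roots k a -> ~ long_roots k a.
Proof.
move=> [i [j [b [c [ij ea]]]]] [i' [b' eb]].
have nij : i == j = false by apply/negbTE; rewrite -(inj_eq val_inj) ltn_eqF.
have n2 : wdot a a = 2.
  rewrite {1}ea !wdotDl !wdotZl !wdot_eps ea !mxE !eqxx /= [j == i]eq_sym nij.
  rewrite ?mulr1n ?mulr0n ?mulr0 ?addr0 ?add0r ?mulr1.
  by case: b {ea}; case: c => /=; ring.
have n4 : wdot a a = 4.
  rewrite {1}eb !wdotZl !wdot_eps eb !mxE !eqxx /=.
  by case: b' {eb} => /=; ring.
by have := n2; rewrite n4.
Qed.

Lemma rho_positive a : positive_roots k a -> 0 < wdot a (rho k).
Proof.
have rE i : rho k 0 i = (k - i)%N%:R by rewrite mxE.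
have rp i : 0 < rho k 0 i by rewrite rE ltr0n subn_gt0.
case=> [[i [j [ij [->|->]]]]|[i ->]].
- rewrite wdotDl -scaleN1r wdotZl !wdot_eps mulN1r subr_gt0 !rE ltr_nat.
  by have := ltn_ord j; lia.
- by rewrite wdotDl !wdot_eps addr_gt0.
- by rewrite wdotZl wdot_eps mulr_gt0.
Qed.

(** The pairing with [rho] is positive on positive roots, which makes [root_le]
    antisymmetric. *)
Lemma root_le_rho a b : root_le a b ->
  wdot a (rho k) <= wdot b (rho k) ?= iff (a == b).
Proof.
move=> [s [hs es]]; apply/leifP.
have -> : wdot b (rho k) = wdot a (rho k) + \sum_(c <- s) wdot c (rho k).
  have -> : b = a + \sum_(c <- s) c by rewrite -es addrC subrK.
  rewrite wdotDl; congr (_ + _).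
  apply: (big_morph (fun x => wdot x (rho k))) => [x y|]; first exact: wdotDl.
  by rewrite /wdot big1 // => i _; rewrite mxE mul0r.
case: s hs es => [|c s] hs es.
  by move/eqP: es; rewrite big_nil subr_eq0 eq_sym => ->; rewrite big_nil addr0.
have pos : 0 < \sum_(c <- c :: s) wdot c (rho k).
  rewrite big_cons; apply: ltr_pwDl; first exact/rho_positive/hs/mem_head.
  rewrite big_seq; apply: sumr_ge0 => x hx; apply/ltW/rho_positive/hs.
  by rewrite inE hx orbT.
case: eqP => [eab|_]; last by rewrite ltrDl.
have : 0 = \sum_(c <- c :: s) wdot c (rho k).
  transitivity (wdot (b - a) (rho k)).
    by rewrite eab subrr /wdot big1 // => i _; rewrite mxE mul0r.
  rewrite es; apply: (big_morph (fun x => wdot x (rho k))) => [x y|]; first exact: wdotDl.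
  by rewrite /wdot big1 // => i _; rewrite mxE mul0r.
by move=> e0; rewrite -e0 ltxx in pos.
Qed.

Lemma min_GammaE (lam g : 'rV[rat]_k) : is_least_Gamma lam g -> min_Gamma lam = g.
Proof.
move=> [hg ming]; apply: xget_unique => // b [hb minb].
have := root_le_rho (ming _ hb); have := root_le_rho (minb _ hg).
move=> [le1 eq1] [le2 eq2]; apply/eqP; rewrite -eq1.
by rewrite eq_le le1 le2.
Qed.

Lemma root_le_eps i i' j j' : (i <= i')%N -> (j <= j')%N ->
  root_le (eps i' + eps j') (eps i + eps j).
Proof.
move=> hi hj.
have step (x y : 'I_k) : (x <= y)%N -> exists2 s : seq 'rV[rat]_k,
    (forall c, c \in s -> positive_roots k c) & eps x - eps y = \sum_(c <- s) c.
  rewrite leq_eqVlt => /orP[/eqP/val_inj ->|lt].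
    by exists [::]; rewrite // subrr big_nil.
  exists [:: eps x - eps y]; last by rewrite big_seq1.
  by move=> c; rewrite inE => /eqP ->; left; exists x, y; split=> //; left.
have [s hs es] := step _ _ hi; have [s' hs' es'] := step _ _ hj.
exists (s ++ s'); split; last by rewrite big_cat -es -es' opprD addrACA.
by move=> c; rewrite mem_cat => /orP[/hs|/hs'].
Qed.

Definition nonsingular (c : 'rV[rat]_k) i := forall p, c 0 i + c 0 p != 0.

Section Gamma.
Variables lam c : 'rV[rat]_k.
Hypothesis cE : c = lam + rho k.
Hypothesis c_inj : forall i j, c 0 i = c 0 j -> i = j.

(** A root orthogonal to [c] makes two coordinates of [c] equal or opposite, and
    the coordinates of [c] are distinct. *)
Lemma Psi_nonsingular i b : nonsingular c i -> Psi lam b -> b 0 i = 0.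
Proof.
move=> ns [[[p [q [e [f [pq eb]]]]]|[p [e eb]]]]; rewrite -cE.
  rewrite eb wdotDl !wdotZl !wdot_eps [(_ + _ : 'rV_k) 0 i]mxE !scale_epsE => h.
  have [epi|npi] := eqVneq i p; have [eqi|nqi] := eqVneq i q.
  - by rewrite -epi -eqi ltnn in pq.
  - subst i; exfalso; move: h; have := ns q; case: e {eb}; case: f;
      rewrite /= ?expr0 ?expr1 ?mul1r ?mulN1r => /eqP h1 h2.
    + by apply: h1; lra.
    + have /c_inj e' : c 0 p = c 0 q by lra.
      by rewrite e' eqxx in nqi.
    + have /c_inj e' : c 0 p = c 0 q by lra.
      by rewrite e' eqxx in nqi.
    + by apply: h1; lra.
  - subst i; exfalso; move: h; have := ns p; case: e {eb}; case: f;
      rewrite /= ?expr0 ?expr1 ?mul1r ?mulN1r => /eqP h1 h2.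
    + by apply: h1; lra.
    + have /c_inj e' : c 0 p = c 0 q by lra.
      by rewrite e' eqxx in npi.
    + have /c_inj e' : c 0 p = c 0 q by lra.
      by rewrite e' eqxx in npi.
    + by apply: h1; lra.
  by rewrite !mulr0n !mulr0 addr0.
rewrite eb !wdotZl wdot_eps scalerA scale_epsE => h.
have [epi|npi] := eqVneq i p; last by rewrite !mulr0n !mulr0.
subst i; exfalso; have /eqP := ns p; apply; move: h.
by case: e {eb}; rewrite /= ?expr0 ?expr1 ?mul1r ?mulN1r; lra.
Qed.

Lemma Gamma_intro i j (m : nat) : (i <= j)%N -> nonsingular c i -> nonsingular c j ->
  (0 < m)%N -> (if i == j then c 0 i else c 0 i + c 0 j) = m%:R ->
  (i = j -> forall p, c 0 p != 0) -> Gamma lam (eps i + eps j).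
Proof.
move=> ij nsi nsj m0 em nz; split.
- by exists i, j.
- by exists m => //; rewrite -cE wdot_coroot.
- move=> b Pb; rewrite wdotDl !wdot_eps !Psi_nonsingular ?addr0 //.
move=> [b [_ hb] [p [e eb]]].
have [eij|nij] := eqVneq i j.
  exfalso; have /eqP := nz eij p; apply; move: hb; rewrite -cE eb !wdotZl wdot_eps.
  by case: e {eb}; rewrite /= ?expr0 ?expr1 ?mul1r ?mulN1r; lra.
exists i, j, false, false; rewrite !expr0 !scale1r; split=> //.
by rewrite ltn_neqAle ij andbT.
Qed.

Lemma Gamma_elim a : Gamma lam a -> exists i j,
  [/\ (i <= j)%N, a = eps i + eps j, nonsingular c i /\ nonsingular c j,
      0 < c 0 i + c 0 j
    & i = j -> (exists m : nat, c 0 i = m%:R) /\ forall p, c 0 p != 0].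
Proof.
move=> [[i [j [ij ea]]] [m m0]]; rewrite -cE ea wdot_coroot => em orth long.
have Psi_pair x p : c 0 x + c 0 p = 0 -> Psi lam (eps x + eps p).
  move=> h; split; last by rewrite -cE wdotDl !wdot_eps.
  case: (ltngtP x p) => [xp|px|/val_inj exp].
  - by left; exists x, p, false, false; rewrite !expr0 !scale1r.
  - by left; exists p, x, false, false; rewrite !expr0 !scale1r addrC.
  by right; exists x, false; rewrite expr0 scale1r -exp scaler_nat mulr2n.
have ns x y : (forall b, Psi lam b -> b 0 x + b 0 y = 0) -> nonsingular c x.
  move=> h p; apply/eqP => /Psi_pair /h; rewrite !mxE !eqxx /= => e.
  have : 0 < (1 + (x == p)%:R + ((y == x)%:R + (y == p)%:R) : rat).
    by rewrite -!addrA ltr_pwDl // !addr_ge0 ?ler0n.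
  by rewrite -[X in _ < X]/(1 + _ + (_ + _)) e ltxx.
have orth' b : Psi lam b -> b 0 i + b 0 j = 0.
  by move/orth; rewrite wdotDl !wdot_eps.
exists i, j; split=> //.
- split; first exact: ns orth'.
  by apply: (ns _ i) => b /orth'; rewrite addrC.
- have m0' : (0 : rat) < m%:R by rewrite ltr0n.
  by move: em; case: eqP => [->|_] em; lra.
move=> eij; rewrite eij eqxx in em; split; first by exists m; rewrite eij.
move=> p; apply/negP => /eqP cp; apply: (@short_not_long a).
  rewrite ea; apply: long; exists (eps p + eps p); first by apply: Psi_pair; rewrite cp addr0.
  by exists p, false; rewrite expr0 scale1r scaler_nat mulr2n.
by exists i, false; rewrite expr0 scale1r ea eij scaler_nat mulr2n.
Qed.

End Gamma.
End Roots.

(** * Diagrams *)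

Lemma partition_nth_gt (s : seq nat) c j : is_partition s ->
  (c < nth 0 s j)%N = (j < count (fun r => c < r) s)%N.
Proof.
rewrite /is_partition; elim: s j => [|x s IH] j /=; first by rewrite nth_nil.
move=> hs; have hs' := path_sorted hs.
have geq_trans : transitive geq by move=> a b e /= h1 h2; exact: leq_trans h2 h1.
have /allP hx : all (geq x) s by apply: order_path_min hs.
have [cx|cx] := ltnP c x; first by case: j => [|j] //=; rewrite add1n ltnS IH.
have -> : count (fun r => c < r)%N s = 0%N.
  apply/eqP; rewrite -leqn0 leqNgt -has_count; apply/hasPn => r /hx /= h.
  by rewrite -leqNgt (leq_trans h).
case: j => [|j] /=; first by rewrite ltnNge cx.
apply/negbTE; rewrite -leqNgt; have [hj|hj] := ltnP j (size s); last by rewrite nth_default.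
by apply: leq_trans cx; apply: hx; exact: mem_nth.
Qed.

Lemma sum_lt_const (c N : nat) : (\sum_(0 <= j < N) (j < c) = minn c N)%N.
Proof.
elim: N => [|N IH]; first by rewrite big_geq // minn0.
by rewrite big_nat_recr //= IH; lia.
Qed.

Lemma boxes2_nth s : boxes2 s = (\sum_(0 <= j < size s) minn (nth 0 s j) 2)%N.
Proof. by rewrite /boxes2 (big_nth 0%N). Qed.

Lemma depth_nth s : depth s = (\sum_(0 <= j < size s) (0 < nth 0 s j))%N.
Proof. by rewrite /depth -sum1_count big_mkcond (big_nth 0%N). Qed.

Lemma nth_part_add s u j : nth 0%N (part_add s u) j = (nth 0 s j + nth 0 u j)%N.
Proof.
rewrite /part_add; have [h|h] := ltnP j (maxn (size s) (size u)).
  by rewrite nth_mkseq.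
rewrite nth_default ?size_mkseq //; move: h; rewrite geq_max => /andP[h1 h2].
by rewrite !nth_default.
Qed.

Lemma is_partition_nth s : (forall j, nth 0 s j.+1 <= nth 0 s j)%N -> is_partition s.
Proof. by move=> h; apply/(sortedP 0%N) => j _ /=; exact: h. Qed.

Section TwoColumns.
Variables (n k t d : nat) (s : seq nat).
Hypotheses (hO : in_Omega n k s) (hT : has_type s t d).

Lemma Omega_partition : is_partition s.
Proof. by case/andP: hO => /and3P[]. Qed.

Lemma Omega_count2 : count (fun r => 1 < r)%N s = t.
Proof.
case/andP: hO => _ /allP le2; case: hT => <- _; apply: eq_in_count => r /le2.
by case: r => [|[|[|]]].
Qed.

Lemma Omega_nth j : nth 0%N s j = ((j < d) + (j < t))%N.
Proof.
have hp := Omega_partition.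
case: (hT) => _ <-; rewrite -[t in RHS]Omega_count2 -!partition_nth_gt //.
case/andP: hO => _ /allP le2.
have [hj|hj] := ltnP j (size s); last by rewrite nth_default.
by have := le2 _ (mem_nth 0%N hj); case: (nth _ _ _) => [|[|[|]]].
Qed.

Lemma Omega_bounds : [/\ (t <= d)%N, (d <= k)%N & (t + d <= n)%N].
Proof.
have le_td : (t <= d)%N.
  by case: (hT) => _ <-; rewrite -Omega_count2; apply: sub_count => r /=; lia.
have ed : (d <= size s)%N by case: (hT) => _ <-; exact: count_size.
case/andP: (hO) => /and3P[_ hb hd] _; split=> //; first by case: hT => _ <-.
move: hb; rewrite boxes2_nth.
rewrite (eq_big_nat _ _ (F2 := fun j => ((j < d) + (j < t))%N)).
  by rewrite big_split /= !sum_lt_const; lia.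
by move=> j _; rewrite Omega_nth; case: (j < d)%N; case: (j < t)%N.
Qed.

End TwoColumns.

Lemma in_Sigma_add n k t d s mu : in_Omega n k s -> has_type s t d ->
  is_partition mu -> size mu = t -> in_Sigma n k (part_add s mu).
Proof.
move=> hO hT hmu smu; have [le_td le_dk le_tdn] := Omega_bounds hO hT.
have E j : nth 0%N (part_add s mu) j = ((j < d) + (j < t) + nth 0 mu j)%N.
  by rewrite nth_part_add (Omega_nth hO hT).
have mu0 j : (t <= j)%N -> nth 0%N mu j = 0%N by move=> h; rewrite nth_default ?smu.
apply/and3P; split.
- apply: is_partition_nth => j; rewrite !E.
  by have := partition_nth_le hmu (leqnSn j); lia.
- rewrite boxes2_nth (eq_big_nat _ _ (F2 := fun j => ((j < d) + (j < t))%N)).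
    by rewrite big_split /= !sum_lt_const; lia.
  move=> j _; rewrite E; have [h|h] := ltnP j t; last by rewrite mu0 // addn0; case: (j < d)%N.
  by rewrite (leq_trans h) //; lia.
rewrite depth_nth (eq_big_nat _ _ (F2 := fun j => (j < d)%N : nat)).
  by rewrite sum_lt_const; lia.
move=> j _; rewrite E; have [h|h] := ltnP j t; first by rewrite (leq_trans h).
by rewrite mu0 // addn0; case: (j < d)%N.
Qed.

(** * The minimal root and the weight *)

Section Coordinates.
Variables (n k t d : nat) (mu : seq nat).
Hypotheses (le_td : (t <= d)%N) (le_dk : (d <= k)%N) (le_tdn : (t + d <= n)%N).
Hypotheses (hmu : is_partition mu) (smu : (size mu <= t)%N).

(** [ucoord j - n / 2] is the coordinate of lambda + rho whose position, counted
    from the last one, is [j]. *)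
Definition ucoord (j : nat) : int := j.+1%:Z - ((j < d) + (j < t) + nth 0 mu j)%N%:Z.

Lemma ucoord_lo j : (j < t)%N -> ucoord j + 2 <= t%:Z.
Proof. by move=> h; rewrite /ucoord h (leq_trans h) //; lia. Qed.

Lemma ucoord_mid j : (t <= j)%N -> (j < d)%N -> ucoord j = j.
Proof. by move=> h h'; rewrite /ucoord h' ltnNge h nth_default; [lia | exact: leq_trans h]. Qed.

Lemma ucoord_hi j : (d <= j)%N -> ucoord j = j.+1.
Proof.
move=> h; rewrite /ucoord ltnNge h ltnNge (leq_trans le_td h) nth_default; first by lia.
by apply: leq_trans smu _; exact: leq_trans h.
Qed.

Lemma ucoord_mono i j : (i < j)%N -> ucoord i < ucoord j.
Proof.
move=> h; rewrite /ucoord; have := partition_nth_le hmu (ltnW h).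
have : ((j < d) <= (i < d))%N by lia.
have : ((j < t) <= (i < t))%N by lia.
by lia.
Qed.

Lemma ucoord_inj i j : ucoord i = ucoord j -> i = j.
Proof.
by move=> e; case: (ltngtP i j) => // /ucoord_mono; rewrite e ltxx.
Qed.

Lemma ucoord_le j : (j < k)%N -> ucoord j <= k%:Z.
Proof. by rewrite /ucoord; lia. Qed.

Definition ucoord_nonsingular a := forall p, (p < k)%N -> ucoord a + ucoord p != n%:Z.

(** If [a < t], then [n - ucoord a] exceeds [d]; not being attained, it exceeds [k]
    as well, and hence every [ucoord b]. *)
Lemma nonsingular_ge_t a b : (b < k)%N -> ucoord_nonsingular a ->
  n%:Z < ucoord a + ucoord b -> (t <= a)%N.
Proof.
move=> bk ns pos; rewrite leqNgt; apply/negP => at_.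
have h1 := ucoord_lo at_; have h2 := ucoord_le bk.
have hp : exists2 p, (d <= p < k)%N & p.+1%:Z = n%:Z - ucoord a.
  by exists (`|n%:Z - ucoord a|%N.-1); lia.
case: hp => p /andP[dp pk] ep; have /eqP := ns p pk; have := ucoord_hi dp; lia.
Qed.

Lemma ucoord_surj (x : nat) : (t <= x)%N -> (x <= k)%N -> x != d ->
  exists2 p, (p < k)%N & ucoord p = x.
Proof.
move=> tx xk nxd; have [xd|dx] := ltnP x d; first by exists x; [lia | exact: ucoord_mid].
by exists x.-1; [lia | rewrite ucoord_hi; lia].
Qed.

Lemma ucoord_neq_d a : (t <= a)%N -> ucoord a != d%:Z.
Proof.
by move=> ta; have [h|h] := ltnP a d; [rewrite ucoord_mid | rewrite ucoord_hi]; lia.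
Qed.

Lemma nonsingular_cases a b : (t <= a)%N -> (b < k)%N -> ucoord_nonsingular a ->
  n%:Z < ucoord a + ucoord b -> ucoord a = n%:Z - d%:Z \/ n%:Z - t%:Z < ucoord a.
Proof.
move=> ta bk ns pos; have bk' := ucoord_le bk.
case: (ltrP (n%:Z - t%:Z) (ucoord a)) => h; [by right | left].
apply/eqP; apply: contraT => /eqP ne.
have ta' : t%:Z <= ucoord a.
  by have [ad|da] := ltnP a d; [rewrite ucoord_mid | rewrite ucoord_hi]; lia.
have [x ex] : exists x : nat, x%:Z = n%:Z - ucoord a by exists `|n%:Z - ucoord a|%N; lia.
have [|||p pk ep] := @ucoord_surj x; [lia..|].
by have /eqP := ns p pk; lia.
Qed.

(** The index where [ucoord] is [n - d]; if [n - d = d], a value that [ucoord] does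
    not take, the minimal root is long and both its indices are [n - t]. *)
Definition jmin : nat :=
  if (n - d < d)%N then (n - d)%N else if n == d.*2 then (n - t)%N else (n - d).-1.

(** A nonsingular value in the range from [t] to [n - t] can only be [n - d], whose
    opposite is the gap [d].  A pair of sum greater than [n] thus consists of
    values at least [n - d] and [n - t + 1]; the case where both are [n - d] is
    excluded by the conditions on long roots. *)
Lemma nonsingular_pair_min a b : (a <= b)%N -> (b < k)%N ->
  ucoord_nonsingular a -> ucoord_nonsingular b -> n%:Z < ucoord a + ucoord b ->
  (a = b -> (exists m : int, ucoord a *+ 2 - n%:Z = m *+ 2) /\
            forall p, (p < k)%N -> ucoord p *+ 2 != n%:Z) ->
  [/\ (n < t + k)%N, (jmin <= a)%N & (n - t <= b)%N].
Proof.
move=> ab bk nsa nsb pos diag.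
have ak : (a < k)%N := leq_ltn_trans ab bk.
have pos' : n%:Z < ucoord b + ucoord a by rewrite addrC.
have ta := nonsingular_ge_t bk nsa pos.
have tb := leq_trans ta ab.
have Uab : ucoord a <= ucoord b.
  move: ab; by rewrite leq_eqVlt => /orP[/eqP ->//|/ucoord_mono/ltW].
have Ubk := ucoord_le bk; have nda := ucoord_neq_d ta.
have Ua : ucoord a = a%:Z /\ (a < d)%N \/ ucoord a = a.+1%:Z /\ (d <= a)%N.
  by have [h|h] := ltnP a d; [left; rewrite ucoord_mid | right; rewrite ucoord_hi].
have Ub : ucoord b = b%:Z /\ (b < d)%N \/ ucoord b = b.+1%:Z /\ (d <= b)%N.
  by have [h|h] := ltnP b d; [left; rewrite ucoord_mid | right; rewrite ucoord_hi].
have ca := nonsingular_cases ta bk nsa pos.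
case: (nonsingular_cases tb ak nsb pos') => cb; last first.
  by rewrite /jmin; split; do ?case: ifP; lia.
have eab : a = b by apply: ucoord_inj; lia.
case: (diag eab) => -[m em] nz.
have [x ex] : exists x : nat, x%:Z = n%:Z - d%:Z - m by exists (absz (n%:Z - d%:Z - m)%R); lia.
have [|||p pk ep] := @ucoord_surj x; [lia..|].
by have /eqP := nz p pk; lia.
Qed.

Variable s : seq nat.
Hypothesis sE : forall j, nth 0%N s j = ((j < d) + (j < t) + nth 0 mu j)%N.
Local Notation lam := (sharp n k s).
Local Notation c := (lam + rho k).

Lemma coordE i : c 0 i = (ucoord (rev_ord i))%:~R - n%:R / 2 :> rat.
Proof.
rewrite /sharp /rho 3!mxE sE /ucoord rmorphB /= -!pmulrn.
have -> : (k - i = (rev_ord i).+1)%N by have := ltn_ord i; rewrite /=; lia.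
by ring.
Qed.

Lemma coordD i j : c 0 i + c 0 j = (ucoord (rev_ord i) + ucoord (rev_ord j) - n%:Z)%:~R :> rat.
Proof.
rewrite !coordE; move: (ucoord _) (ucoord _) => x y.
by rewrite rmorphB rmorphD /= -pmulrn; field.
Qed.

Lemma coord_inj i j : c 0 i = c 0 j -> i = j.
Proof.
rewrite !coordE => /addIr /intr_inj /ucoord_inj e; apply: rev_ord_inj; exact: val_inj.
Qed.

Lemma coord_nonsingular i : nonsingular c i <-> ucoord_nonsingular (rev_ord i).
Proof.
split=> ns p; last by rewrite coordD intr_eq0 subr_eq0; exact: ns.
move=> pk; have := ns (rev_ord (Ordinal pk)).
by rewrite coordD rev_ordK intr_eq0 subr_eq0.
Qed.

Lemma Gamma_bounds a : Gamma lam a -> (n < t + k)%N /\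
  exists i j : 'I_k, [/\ a = eps i + eps j, (n - t <= rev_ord i)%N & (jmin <= rev_ord j)%N].
Proof.
case/(Gamma_elim erefl) => i [j [ij ea [nsi nsj] pos diag]].
have rij : (rev_ord j <= rev_ord i)%N by rewrite /= leq_sub2l.
have posU : n%:Z < ucoord (rev_ord j) + ucoord (rev_ord i).
  by move: pos; rewrite coordD ltr0z subr_gt0 addrC.
have diagU : rev_ord j = rev_ord i :> nat ->
    (exists m : int, ucoord (rev_ord j) *+ 2 - n%:Z = m *+ 2)
    /\ forall p, (p < k)%N -> ucoord p *+ 2 != n%:Z.
  move=> /val_inj/rev_ord_inj eij; have [[m em] nz] := diag (esym eij).
  split=> [|p pk].
    exists m%:Z; apply: (@intr_inj rat).
    rewrite rmorphB !rmorphMn /= -!pmulrn -em -eij coordE.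
    by move: (ucoord _) => x; field.
  have := nz (rev_ord (Ordinal pk)); rewrite coordE rev_ordK /=.
  apply: contra => /eqP e; rewrite subr_eq0; apply/eqP.
  have : (ucoord p *+ 2)%:~R = n%:R :> rat by rewrite e.
  by rewrite rmorphMn /= => <-; move: (ucoord p) => x; field.
have [h1 h2 h3] := nonsingular_pair_min rij (ltn_ord _)
  ((coord_nonsingular j).1 nsj) ((coord_nonsingular i).1 nsi) posU diagU.
by split=> //; exists i, j.
Qed.

Hypothesis lt_ntk : (n < t + k)%N.

Lemma ucoord_jmin : n != d.*2 -> ucoord jmin = n%:Z - d%:Z.
Proof.
move=> nd; rewrite /jmin (negPf nd); case: ltnP => h; first by rewrite ucoord_mid; lia.
by rewrite ucoord_hi; lia.
Qed.

Lemma ucoord_jmax : ucoord (n - t) = n%:Z - t%:Z + 1.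
Proof. by rewrite ucoord_hi; lia. Qed.

Lemma ucoord_values j :
  [\/ ucoord j + 2 <= t%:Z, ucoord j = j%:Z /\ (t <= j < d)%N
    | ucoord j = j.+1%:Z /\ (d <= j)%N].
Proof.
have [h|h] := ltnP j t; first by apply: Or31; exact: ucoord_lo.
have [h'|h'] := ltnP j d; first by apply: Or32; rewrite ucoord_mid // h.
by apply: Or33; rewrite ucoord_hi.
Qed.

Lemma jmin_nonsingular : n != d.*2 -> ucoord_nonsingular jmin.
Proof.
move=> nd p pk; rewrite ucoord_jmin //; apply/eqP => e.
by case: (ucoord_values p) => [?|[? /andP[? ?]]|[? ?]]; lia.
Qed.

Lemma jmax_nonsingular : ucoord_nonsingular (n - t).
Proof.
move=> p pk; rewrite ucoord_jmax; apply/eqP => e.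
by case: (ucoord_values p) => [?|[? /andP[? ?]]|[? ?]]; lia.
Qed.

(** The coordinates after reflection: [n - t + 1] and [n - d] have become [d] and
    [t - 1], the two gaps of [ucoord] between [t - 2] and [k]; if [n - d = d], only
    [n - t + 1] changes, and becomes [t - 1]. *)
Definition ucoord_refl (j : nat) : int :=
  if j == (n - t)%N then n%:Z - ucoord jmin
  else if j == jmin then n%:Z - ucoord (n - t) else ucoord j.

(** The analogue of [ucoord] for the two-column diagram with [n - d + 1] entries 2
    and depth [n - t + 1], plus [mu]. *)
Definition ucoord_target (j : nat) : int :=
  j.+1%:Z - ((j < (n - d).+1) + (j < (n - t).+1) + nth 0 mu j)%N%:Z.

Lemma ucoord_target_mono i j : (i < j)%N -> ucoord_target i < ucoord_target j.
Proof.
move=> h; rewrite /ucoord_target; have := partition_nth_le hmu (ltnW h).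
have : ((j < (n - d).+1) <= (i < (n - d).+1))%N by lia.
have : ((j < (n - t).+1) <= (i < (n - t).+1))%N by lia.
by lia.
Qed.

Lemma jmin_eq : n = d.*2 -> jmin = (n - t)%N.
Proof. by rewrite /jmin => e; rewrite e eqxx ifF //; lia. Qed.

Lemma ucoord_reflE j : [\/ j = (n - t)%N /\ ucoord_refl j = (if n == d.*2 then t%:Z - 1 else d%:Z),
                 [/\ j = jmin, n != d.*2 & ucoord_refl j = t%:Z - 1]
               | [/\ j != (n - t)%N, j != jmin & ucoord_refl j = ucoord j]].
Proof.
rewrite /ucoord_refl; case: eqP => [->|nj].
  apply: Or31; split=> //; case: eqP => [/jmin_eq ->|/eqP /ucoord_jmin ->]; last by lia.
  by rewrite ucoord_jmax; lia.
case: eqP => [ej|nj']; last by apply: Or33; split=> //; exact/eqP.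
apply: Or32; split=> //; last by rewrite ucoord_jmax; lia.
by apply/eqP => /jmin_eq e; apply: nj; rewrite ej e.
Qed.

Lemma ucoord_refl_inj i j : ucoord_refl i = ucoord_refl j -> i = j.
Proof.
have Ud x : ucoord x <> d%:Z.
  by move=> e; case: (ucoord_values x) => [?|[? /andP[? ?]]|[? ?]]; lia.
have Ut x : ucoord x <> t%:Z - 1.
  by move=> e; case: (ucoord_values x) => [?|[? /andP[? ?]]|[? ?]]; lia.
have hd : d%:Z <> t%:Z - 1 by lia.
case: (ucoord_reflE i) => [[-> ->]|[-> ni ->]|[ni1 ni2 ->]];
  case: (ucoord_reflE j) => [[-> ->]|[-> nj ->]|[nj1 nj2 ->]] //.
- by rewrite (negPf nj) => /hd.
- by case: eqP => _ /esym; [move/Ut | move/Ud].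
- by rewrite (negPf ni) => /esym/hd.
- by move/esym/Ut.
- by case: eqP => _; [move/Ut | move/Ud].
- by move/Ut.
exact: ucoord_inj.
Qed.

Lemma ucoord_refl_image j : (j < k)%N -> exists2 i, (i < k)%N & ucoord_refl j = ucoord_target i.
Proof.
move=> jk.
have tgt1 i : (t <= i)%N -> (i <= n - d)%N -> ucoord_target i = i%:Z - 1.
  by move=> h1 h2; rewrite /ucoord_target nth_default ?(leq_trans smu) //; lia.
have tgt2 i : (n - d < i)%N -> (i <= n - t)%N -> ucoord_target i = i%:Z.
  move=> h1 h2; rewrite /ucoord_target nth_default; first by lia.
  by apply: leq_trans smu _; lia.
have tgt3 i : (n - t < i)%N -> ucoord_target i = i.+1%:Z.
  move=> h1; rewrite /ucoord_target nth_default; first by lia.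
  by apply: leq_trans smu _; lia.
have tgt0 i : (i < t)%N -> ucoord_target i = ucoord i by rewrite /ucoord_target /ucoord; lia.
have at_t : exists2 i, (i < k)%N & t%:Z - 1 = ucoord_target i.
  by exists t; [lia | rewrite tgt1; lia].
have at_d : n != d.*2 -> exists2 i, (i < k)%N & d%:Z = ucoord_target i.
  move=> nd; have [h|h] := ltnP d (n - d).
    by exists d.+1; [|rewrite tgt1]; lia.
  by exists d; [|rewrite tgt2]; lia.
case: (ucoord_reflE j) => [[ej ->]|[ej nd ->]|[nj1 nj2 ->]] //; first by case: eqP => [_|/eqP /at_d].
case: (ltnP j t) => jt; first by exists j; rewrite ?tgt0.
have nU1 : ucoord j <> n%:Z - t%:Z + 1.
  by rewrite -ucoord_jmax => /ucoord_inj e; rewrite e eqxx in nj1.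
have nU2 : ucoord j <> n%:Z - d%:Z.
  have [e|ne] := eqVneq n d.*2; last first.
    by rewrite -ucoord_jmin // => /ucoord_inj e; rewrite e eqxx in nj2.
  by have /eqP := ucoord_neq_d jt; lia.
have [x [tx xk] ex] : exists2 x : nat, (t <= x)%N /\ (x <= k)%N & ucoord j = x%:Z.
  have [h|h] := ltnP j d; first by exists j; rewrite ?ucoord_mid; lia.
  by exists j.+1; rewrite ?ucoord_hi; lia.
rewrite ex in nU1 nU2 *.
have [h|h] := ltnP x (n - d); first by exists x.+1; [lia | rewrite tgt1; lia].
have [h'|h'] := ltnP x (n - t).+1; first by exists x; [lia | rewrite tgt2; lia].
by exists x.-1; [lia | rewrite tgt3; lia].
Qed.

Fact jmax_lt : (n - t < k)%N. Proof. by lia. Qed.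
Fact jmin_lt : (jmin < k)%N. Proof. by rewrite /jmin; do ?case: ifP; lia. Qed.
Local Notation imin := (rev_ord (Ordinal jmax_lt)).
Local Notation imax := (rev_ord (Ordinal jmin_lt)).

Lemma is_least_Gamma_min : is_least_Gamma lam (eps imin + eps imax).
Proof.
split; last first.
  move=> b /Gamma_bounds[_ [i [j [-> h1 h2]]]]; apply: root_le_eps => /=.
    by move: h1 => /=; have := ltn_ord i; lia.
  by move: h2 => /=; have := ltn_ord j; have := jmin_lt; lia.
have nsi : nonsingular c imin.
  by apply/coord_nonsingular; rewrite rev_ordK; exact: jmax_nonsingular.
have le_jj : (jmin <= n - t)%N by rewrite /jmin; do ?case: ifP; lia.
have rle : (imin <= imax)%N by rewrite /= leq_sub2l.
have [e2d|n2d] := eqVneq n d.*2.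
  have emM : imax = imin by congr rev_ord; apply: val_inj; rewrite /= jmin_eq.
  rewrite emM; apply: (Gamma_intro erefl coord_inj (m := (d - t).+1)) => //.
    rewrite eqxx coordE rev_ordK /= ucoord_jmax //.
    rewrite e2d -mul2n natrM mulrAC divff ?mul1r ?pnatr_eq0 //.
    have -> : (2 * d)%N%:Z - t%:Z + 1 = (d - t).+1%:Z + d%:Z by lia.
    by rewrite rmorphD /= addrK.
  move=> _ p; rewrite coordE subr_eq0; apply/eqP => e.
  have e' : ucoord (rev_ord p) *+ 2 = n%:Z.
    by apply: (@intr_inj rat); rewrite rmorphMn /= e -pmulrn; move: (n%:R : rat) => x; field.
  by case: (ucoord_values (rev_ord p)) => [?|[? /andP[? ?]]|[? ?]]; lia.
have nsM : nonsingular c imax.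
  by apply/coord_nonsingular; rewrite rev_ordK; exact: jmin_nonsingular.
have ne : imin == imax = false.
  apply/negbTE; apply: contra n2d => /eqP/rev_ord_inj/(congr1 val) /=.
  by rewrite /jmin; do ?case: ifP; lia.
apply: (Gamma_intro erefl coord_inj (m := (n - d - t).+1)) => //.
  rewrite ne coordD !rev_ordK /= ucoord_jmax // ucoord_jmin //.
  have -> : n%:Z - t%:Z + 1 + (n%:Z - d%:Z) - n%:Z = (n - d - t).+1%:Z by lia.
  by rewrite -pmulrn.
by move=> /eqP; rewrite ne.
Qed.

Lemma reflection_coord (i : 'I_k) :
  reflection (min_Gamma lam) c 0 i = (ucoord_refl (rev_ord i))%:~R - n%:R / 2 :> rat.
Proof.
rewrite (min_GammaE is_least_Gamma_min) reflectionE !coordE !rev_ordK /ucoord_refl.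
have eqi (j : 'I_k) : (i == rev_ord j) = (rev_ord i == j :> nat).
  by rewrite -(inj_eq rev_ord_inj) rev_ordK -(inj_eq val_inj).
have neg (x : int) : - (x%:~R - n%:R / 2) = (n%:Z - x)%:~R - n%:R / 2 :> rat.
  by rewrite rmorphB /= -pmulrn; field.
by rewrite !neg !eqi /=; case: ifP => // _; case: ifP.
Qed.

(** The reflected coordinates are distinct and occur among those of the expected
    weight, which decrease strictly; equality of the numbers of coordinates then
    identifies their decreasing rearrangement. *)
Lemma lambda_primeE (i : 'I_k) : lambda_prime n k s 0 i
  = - ((rev_ord i < (n - d).+1) + (rev_ord i < (n - t).+1) + nth 0 mu (rev_ord i))%N%:R
    - n%:R / 2.
Proof.
pose w (j : nat) : rat := (ucoord_target j)%:~R - n%:R / 2.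
pose T := [seq w (rev_ord j) | j <- enum 'I_k].
pose S := [seq reflection (min_Gamma lam) c 0 j | j <- enum 'I_k].
have w_mono x y : (x < y)%N -> w x < w y.
  by move=> h; rewrite ltrD2r ltr_int; exact: ucoord_target_mono.
have sortT : sorted (fun x y : rat => y <= x) T.
  have trans : transitive (fun x y : rat => y <= x) by move=> x y z h1 h2; exact: le_trans h2 h1.
  rewrite sorted_pairwise // pairwise_map.
  have : sorted ltn (map val (enum 'I_k)) by rewrite val_enum_ord iota_ltn_sorted.
  rewrite sorted_pairwise; last exact: ltn_trans.
  rewrite pairwise_map; apply: sub_pairwise => x y /= xy; apply/ltW/w_mono => /=.
  by have := ltn_ord y; lia.
have uniqS : uniq S.
  rewrite map_inj_uniq ?enum_uniq // => x y; rewrite !reflection_coord.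
  by move/addIr/intr_inj/ucoord_refl_inj/val_inj/rev_ord_inj.
have subST : {subset S <= T}.
  move=> x /mapP[j _ ->]; rewrite reflection_coord.
  have [p pk ->] := ucoord_refl_image (ltn_ord (rev_ord j)).
  apply/mapP; exists (rev_ord (Ordinal pk)); first by rewrite mem_enum.
  by rewrite rev_ordK.
have sizeST : (size T <= size S)%N by rewrite !size_map.
have [eqsz eqST] := uniq_min_size uniqS subST sizeST.
have uniqT : uniq T by rewrite -(eq_uniq eqsz eqST).
have sortS : sort (fun x y : rat => y <= x) S = T.
  apply: (@sorted_eq _ (fun x y : rat => y <= x)) => //.
  - by move=> x y z h1 h2; exact: le_trans h2 h1.
  - by move=> x y /andP[h1 h2]; apply/le_anti/andP.
  - by apply: sort_sorted => x y; exact: le_total.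
  by rewrite perm_sort; exact: uniq_perm.
rewrite /lambda_prime /decreasing_rearrangement mxE [X in X + _]mxE -/S sortS.
rewrite (nth_map i) ?size_enum_ord // nth_ord_enum /w /ucoord_target !mxE.
rewrite rmorphB /= -!pmulrn.
have -> : (k - i = (rev_ord i).+1)%N by have := ltn_ord i; rewrite /=; lia.
by ring.
Qed.

End Coordinates.

(** * The determinantal vector *)

Section DetVector.
Variables (C : numFieldType) (n k t d : nat) (mu : seq nat).
Hypotheses (le_td : (t <= d)%N) (le_dk : (d <= k)%N) (le_tdn : (t + d <= n)%N).
Hypotheses (lt_ntk : (n < t + k)%N) (hmu : is_partition mu) (smu : size mu = t).
Local Notation P := {mpoly C[k * n]}.
Local Notation v := (det_vector C n k (d + k - n) (t + k - n) mu).

Lemma det_vector_tens_span (B : {mpoly C[k * n]} -> Prop) :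
  (forall p q, p \in rminors C n k d -> q \in rminors C n k t ->
     B (p * (q * delta_part C n k mu))) ->
  tens_span (invariants C n k) B v.
Proof.
move=> hB; have [s hs es] := det_submx_Mt_expansion C le_td le_dk le_tdn lt_ntk.
exists [seq (x.1, x.2.1 * (x.2.2 * delta_part C n k mu)) | x <- s]; split.
  by move=> _ /mapP[x /hs[h1 h2 h3] ->]; split=> //; exact: hB.
rewrite /det_vector es mulr_suml big_map; apply: eq_bigr => x _ /=.
by rewrite tens1l !tensE !rmorphM /= !mulrA.
Qed.

Lemma det_vector_harmonic : tens_span (invariants C n k) (harmonics C n k) v.
Proof.
apply: det_vector_tens_span => p q /codomP[f ->] /codomP[g ->].
apply: harmonic_rminor_mul le_td le_tdn _ => i c hc.
have := dx_delta_part_eq0 C i smu hc; have := dx_rminor_eq0 C i g hc.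
by rewrite /dx mderivM => -> ->; rewrite mul0r mulr0 addr0.
Qed.

Lemma det_vector_Fmod s :
  (forall j, nth 0%N s j = ((j < d) + (j < t) + nth 0 mu j)%N) ->
  tens_span (invariants C n k) (Fmod C n k s) v.
Proof.
move=> sE; have hd : (d <= minn n k)%N by rewrite leq_min; lia.
have ht : (t <= minn n k)%N by rewrite leq_min; lia.
apply: det_vector_tens_span => p q hp hq; rewrite /Fmod /=.
have bL : bounded n k (column_lengths n k mu) := bounded_column_lengths n k mu.
rewrite (delta_part_add_columns C ht hd hmu sE) delta_part_prod.
have -> : delta_minor C n k d * (delta_minor C n k t * delta_prod C n k (column_lengths n k mu))
    = delta_prod C n k (d :: t :: column_lengths n k mu) by rewrite /delta_prod !big_cons.
apply: minor_products_generated; first by rewrite /bounded /= hd ht.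
do 2!apply: in_span_minor_products => //.
exact: delta_prod_span.
Qed.

Lemma det_vector_highest_weight (w : 'rV[rat]_k) : (0 < d)%N ->
  (forall i : 'I_k, w 0 i = - ((rev_ord i < (n - d).+1) + (rev_ord i < (n - t).+1)
                             + nth 0 mu (rev_ord i))%N%:R - n%:R / 2) ->
  is_highest_weight_vector w v.
Proof.
move=> d0 wE.
have hopE i j u : tens_hop i j u
    = tens_polarization i j u + (n%:R / 2 * (i == j)%:R) *: u :> {mpoly C[k * n + k * n]}.
  by rewrite /tens_polarization subrK.
split=> [|i|i j ij].
- exact: det_vector_neq0.
- rewrite hopE (eigen_tens_polarization_det_vector C (leqnn i)) // eqxx mul1n mulr1.
  rewrite -scaler_nat -scalerDl; congr (_ *: _).
  rewrite wE rmorphB rmorphN /= rmorph_nat fmorph_div !rmorph_nat opprB opprK addrC.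
  congr (_ + (_ + _ + _)%:R); congr nat_of_bool; have := ltn_ord i; rewrite /=; lia.
rewrite hopE (eigen_tens_polarization_det_vector C (ltnW ij)) //.
have ne : (i == j) = false by apply/negbTE; rewrite -(inj_eq val_inj) ltn_eqF.
by rewrite ne eq_sym ne mul0n mulr0n mulr0 scale0r addr0.
Qed.

End DetVector.

Theorem corollary4p1 (R : realType) (n k : nat) (sigma0 mu : seq nat)
    (t d : nat) (hn : (0 < n)%N) (hk : (0 < k)%N)
    (hsigma0 : in_Omega0 n k sigma0) (htype : has_type sigma0 t d)
    (hmu : is_partition mu) (hmut : size mu = t) :
  let sigma := part_add sigma0 mu in
  let a := (d + k - n)%N in
  let b := (t + k - n)%N in
  let v := det_vector R[i] n k a b mu in
  in_Sigma0 n k sigma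
  /\ (n < d + k)%N /\ (n < t + k)%N
  /\ tens_span (invariants R[i] n k) (harmonics R[i] n k) v
  /\ ker_phi R[i] n k sigma v
  /\ ((0 < d)%N -> is_highest_weight_vector (lambda_prime n k sigma) v).
Proof.
move=> sigma a b v; case: hsigma0 => hO [_ [g0 hg0]].
have [le_td le_dk le_tdn] := Omega_bounds hO htype.
have lt_ntk : (n < t + k)%N.
  have sE j : nth 0%N sigma0 j = ((j < d) + (j < t) + nth 0 [::] j)%N.
    by rewrite nth_nil addn0; exact: Omega_nth hO htype j.
  by have [] := Gamma_bounds le_td le_dk le_tdn (isT : is_partition [::]) (leq0n t) sE hg0.
have smu : (size mu <= t)%N by rewrite hmut.
have sE j : nth 0%N sigma j = ((j < d) + (j < t) + nth 0 mu j)%N.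
  by rewrite nth_part_add (Omega_nth hO htype).
split; first split.
- exact: in_Sigma_add hO htype hmu hmut.
- exists (min_Gamma (sharp n k sigma)).
  have hl := is_least_Gamma_min le_td le_dk le_tdn hmu smu sE lt_ntk.
  by rewrite (min_GammaE hl); case: hl.
split; first by lia.
split; first exact: lt_ntk.
split; first exact: det_vector_harmonic.
split; first by split; [exact: det_vector_Fmod | exact: tens_mul_det_vector].
move=> d0; apply: det_vector_highest_weight => // i.
exact: lambda_primeE.
Qed.
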